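(* There exists an absolute constant $C>0$ (independent of $r$ and $d$) such that for every integer $r\geq 2$ and every integer $d\geq 1$, $$R_{\mathbb{F}_2}^{(r)}(2;d) \le C r (\log r+d)^7.$$
   Context: For an $r$-tuple of positive integers $(d_1,\dots,d_r)$, $R_{\mathbb{F}_2}(d_1,\ldots,d_r)$ denotes the smallest $n$ such that for every $r$-coloring $C$ of the one-dimensional linear subspaces of $\mathbb{F}_2^n$ with colors $\{1,\dots,r\}$, there exist some $i\in \{1,\dots,r\}$ and a linear subspace $V\le \mathbb{F}_2^n$ of dimension $d_i$ such that $C(W) = i$ for all one-dimensional subspaces $W \subset V$. (This is finite for every choice of $(d_1,\dots,d_r)$.) The notation $R_{\mathbb{F}_2}^{(r)}(2;d)$ denotes the $r$-color Ramsey number $R_{\mathbb{F}_{2}}(2,\ldots,2,d)$, where the first $r-1$ entries equal $2$ and the last equals $d$. *)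

(* Defs.v *)
From HB Require Import structures.
From mathcomp Require Import all_boot all_order all_algebra.
From mathcomp Require Import all_classical all_reals all_analysis.
Set Implicit Arguments.
Unset Strict Implicit.
Unset Printing Implicit Defensive.
Import Order.TTheory GRing.Theory Num.Theory.

(* One-dimensional linear subspaces of F_2^n. *)
Definition line (n : nat) := {W : {vspace 'rV['F_2]_n} | \dim W == 1}.

(* Colors are indexed from 0: the i-th entry of ds goes with color i : 'I_r. *)
Definition ramsey_property (r : nat) (ds : r.-tuple nat) (n : nat) : Prop :=
  forall C : line n -> 'I_r,
    exists (i : 'I_r) (V : {vspace 'rV['F_2]_n}),
      \dim V = tnth ds i /\
      forall W : line n, (val W <= V)%VS -> C W = i.

(* [is_ramsey_number ds n] reads "R_{F_2}(ds) exists and equals n". The Ramsey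
   number is a relation rather than a function so that no default value is
   needed before finiteness is known. *)
Definition is_ramsey_number (r : nat) (ds : r.-tuple nat) (n : nat) : Prop :=
  ramsey_property ds n /\
  forall m : nat, ramsey_property ds m -> (n <= m)%N.

(* The r-tuple (2, ..., 2, d). *)
Definition twos_then (r d : nat) : r.-tuple nat :=
  [tuple (if i.+1 == r then d else 2) | i < r].

(* Main.v *)
Require Import Defs.
From HB Require Import structures.
From mathcomp Require Import all_boot all_order all_algebra.
From mathcomp Require Import all_classical all_reals all_analysis.
From mathcomp Require Import ring lra zify.
Set Implicit Arguments.
Unset Strict Implicit.
Unset Printing Implicit Defensive.
Import Order.TTheory GRing.Theory Num.Theory.
Local Open Scope ring_scope.

(** Why the theorem is true. A coloring that shows [n] to be too small consists of
    [r - 1] color classes [A i] of nonzero vectors which are sum-free (no [x], [y],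
    [x + y] in [A i]), such that every [d]-dimensional subspace meets their union. A greedy
    construction ([subspace_avoiding]) shows that in any dimension above [d] the union
    has density at least about [2 ^ - d], so some [A i] has density at least [2 ^ - l],
    where [l] is of order [ln r + d].

    The engine is a density increment ([density_increment]): if [D] and [A] have density
    at least [2 ^ - l] and no sum of two elements of [D] lies in [A], then on some coset
    of a subspace of codimension [O(l ^ 6)] the density of [D] grows by the factor
    [17 / 16]. It is applied to a dense color class [A = A i] and to the set [D = D i]
    that this color has inherited from earlier steps (at first [A i] itself). Passing to
    the subspace keeps all the hypotheses, for all the colors at once, and loses nothing
    for the other colors if their cosets are well chosen ([restriction_step]). As a
    density is at most 1, each color is used at most [16 * l] times; so the dimension is
    at most [d + r * (16 * l) * O(l ^ 6)], that is [O(r * l ^ 7)] ([dimension_le]).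

    The density increment follows Kelley and Meka, in the form given by Bloom and Sisask,
    where the group F_2^n and the explicit obstruction allow short cuts. Write [a] for
    the density of [D], and [autocorr D z] for the density of [D] intersected with its
    translate by [z], whose mean is [a ^+ 2].
    - It vanishes on [A], so its deviation from the mean has a large even moment;
      positive-definiteness turns this into a moment of order [8 * l] much larger than
      that of its mean ([unbalancing]).
    - Intersections of random translates of [D] convert the moment into a set [B] of
      density [2 ^ - O(l ^ 2)] such that [autocorr D] is at least [9 / 8 * a ^+ 2] at the
      sum of nearly every pair of elements of [B] ([sifting], [sifted_set]).
    - Random sampling gives a set [T] of density [2 ^ - O(l ^ 6)] such that this pair
      count hardly changes under shifts by sums of [2 * l] elements of [T]
      ([croot_sisask], [smooth_almost_invariant]).
    - Averaging over such shifts suppresses all the frequencies outside the large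
      spectrum of [T], so [D] has excess Fourier mass on that spectrum
      ([smooth_autocorr_le_spectrum]), which spans a space of dimension [O(l ^ 6)]
      ([chang]); this is an increment of density on a coset of its annihilator
      ([slice_increment]). *)


(** * Averages and densities *)

(** Normalized sums make all constants below independent of the dimension. The
    definition is locked so that rewriting with [avgZ] does not look for products
    inside it. *)
HB.lock Definition avg (R : realFieldType) (T : finType) (f : T -> R) : R :=
  #|T|%:R^-1 * \sum_x f x.
Arguments avg {R T} f.

Section Average.
Variables (R : realFieldType).

Lemma avgE (T : finType) (f : T -> R) : avg f = #|T|%:R^-1 * \sum_x f x.
Proof. by rewrite unlock. Qed.

Definition ind (T : finType) (A : {set T}) (x : T) : R := (x \in A)%:R.

Definition dens (T : finType) (A : {set T}) : R := avg (ind A).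

Lemma eq_avg (T : finType) (f g : T -> R) : f =1 g -> avg f = avg g.
Proof. by move=> fg; rewrite !avgE (eq_bigr g). Qed.

Lemma avgD (T : finType) (f g : T -> R) :
  avg (fun x => f x + g x) = avg f + avg g.
Proof. by rewrite !avgE big_split mulrDr. Qed.

Lemma avgZ (T : finType) (c : R) (f : T -> R) :
  avg (fun x => c * f x) = c * avg f.
Proof. by rewrite !avgE -mulr_sumr mulrCA. Qed.

Lemma avgZr (T : finType) (c : R) (f : T -> R) :
  avg (fun x => f x * c) = avg f * c.
Proof. by rewrite mulrC -avgZ; apply: eq_avg => x; rewrite mulrC. Qed.

Lemma avgN (T : finType) (f : T -> R) : avg (fun x => - f x) = - avg f.
Proof. by rewrite -mulN1r -avgZ; apply: eq_avg => x; rewrite mulN1r. Qed.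

Lemma avgB (T : finType) (f g : T -> R) :
  avg (fun x => f x - g x) = avg f - avg g.
Proof. by rewrite avgD avgN. Qed.

Lemma avg_sum (T I : finType) (F : T -> I -> R) :
  avg (fun x => \sum_i F x i) = \sum_i avg (F^~ i).
Proof. by rewrite !avgE exchange_big mulr_sumr; apply: eq_bigr => i _; rewrite avgE. Qed.

Lemma avg_swap (T U : finType) (F : T -> U -> R) :
  avg (fun x => avg (F x)) = avg (fun y => avg (F^~ y)).
Proof.
rewrite !avgE; under eq_bigr do rewrite avgE.
under [in RHS]eq_bigr do rewrite avgE.
by rewrite -!mulr_sumr [in RHS]exchange_big mulrCA.
Qed.

Lemma avg_reindex (T : finType) (h : T -> T) (f : T -> R) :
  injective h -> avg (fun x => f (h x)) = avg f.
Proof. by move=> hI; rewrite !avgE [in RHS](reindex_inj hI). Qed.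

Lemma ler_avg (T : finType) (f g : T -> R) :
  (forall x, f x <= g x) -> avg f <= avg g.
Proof.
by move=> fg; rewrite !avgE; apply: ler_wpM2l; [rewrite invr_ge0 | apply: ler_sum].
Qed.

Lemma avg_ge0 (T : finType) (f : T -> R) : (forall x, 0 <= f x) -> 0 <= avg f.
Proof.
by move=> f0; rewrite avgE; apply: mulr_ge0; [rewrite invr_ge0 | apply: sumr_ge0].
Qed.

Lemma ler_norm_avg (T : finType) (f : T -> R) :
  `|avg f| <= avg (fun x => `|f x|).
Proof.
rewrite !avgE normrM ger0_norm ?invr_ge0 //.
by apply: ler_wpM2l; [rewrite invr_ge0 | apply: ler_norm_sum].
Qed.

Lemma avg_cst (T : finType) (c : R) : (0 < #|T|)%N -> avg (fun _ : T => c) = c.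
Proof.
move=> T0; rewrite !avgE sumr_const -[c *+ _]mulr_natl mulrA mulVf ?mul1r //.
by rewrite pnatr_eq0 -lt0n.
Qed.

Lemma avg_le_max (T : finType) (f : T -> R) :
  (0 < #|T|)%N -> exists x, avg f <= f x.
Proof.
move=> T0; have [/existsP[x fx]|/existsPn H] := boolP [exists x, avg f <= f x].
  by exists x.
exfalso; have : avg f < avg f; last by rewrite ltxx.
rewrite [ltLHS]avgE ltr_pdivrMl ?ltr0n // mulr_natl -sumr_const.
have {H}H x : f x < avg f by rewrite ltNge.
by case/card_gt0P: T0 => x0 _; apply: ltr_sum => //; apply/hasP; exists x0;
   rewrite ?mem_index_enum.
Qed.

Lemma densE (T : finType) (A : {set T}) : dens A = #|T|%:R^-1 * #|A|%:R.
Proof.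
by rewrite /dens !avgE /ind -natr_sum -sum1_card [in RHS]big_mkcond.
Qed.

Lemma dens_ge0 (T : finType) (A : {set T}) : 0 <= dens A.
Proof. by apply: avg_ge0 => x; apply: ler0n. Qed.

Lemma ind_ge0 (T : finType) (A : {set T}) x : 0 <= ind A x.
Proof. exact: ler0n. Qed.

Lemma ind_le1 (T : finType) (A : {set T}) x : ind A x <= 1.
Proof. by rewrite /ind lern1 leq_b1. Qed.

Lemma dens_le1 (T : finType) (A : {set T}) : dens A <= 1.
Proof.
rewrite densE; have [->|T0] := posnP #|T|; first by rewrite invr0 mul0r ler01.
by rewrite ler_pdivrMl ?ltr0n // mulr1 ler_nat max_card.
Qed.

Lemma dens_gt0 (T : finType) (A : {set T}) : (0 < dens A) = (0 < #|A|)%N.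
Proof.
rewrite densE; apply/idP/idP => [|A0]; last first.
  by rewrite mulr_gt0 ?invr_gt0 ?ltr0n // (leq_trans A0) // max_card.
by rewrite lt0n; apply: contraTneq => ->; rewrite mulr0 ltxx.
Qed.

End Average.

(** * Fourier analysis on F_2^n *)

Section Fourier.
Variables (R : realFieldType) (n : nat).
Local Notation G := ('rV['F_2]_n).
Implicit Types (x y z xi eta : G) (f g : G -> R).

Definition dot xi x : 'F_2 := (xi *m x^T) 0 0.

Definition chi xi x : R := (-1) ^+ (dot xi x != 0).

Definition fourier f xi : R := avg (fun x => f x * chi xi x).

(** As [- y = y], this is at once the convolution and the correlation of [f]
    and [g]; in particular [conv f f] has the nonnegative transform [fourier f ^+ 2]. *)
Definition conv f g x : R := avg (fun y => f y * g (x + y)).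

Lemma F2_cases (a : 'F_2) : a = 0 \/ a = 1.
Proof. by case: a => [[|[|//]] ?]; [left|right]; apply: val_inj. Qed.

Lemma rV2_addxx x : x + x = 0.
Proof.
by apply/rowP => i; rewrite !mxE; apply: (addrr_pchar2 (pchar_Fp _)).
Qed.

Lemma rV2_opp x : - x = x.
Proof. by apply/eqP; rewrite eq_sym -subr_eq0 opprK rV2_addxx. Qed.

Lemma rV2_addK x y : x + y + y = x.
Proof. by rewrite -addrA rV2_addxx addr0. Qed.

Lemma rV2_addKl x y : x + (x + y) = y.
Proof. by rewrite addrA rV2_addxx add0r. Qed.

Lemma card_rV2_gt0 : (0 < #|{: G}|)%N.
Proof. by apply/card_gt0P; exists 0. Qed.

Lemma dotC xi x : dot xi x = dot x xi.
Proof.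
by rewrite /dot !mxE; apply: eq_bigr => i _; rewrite !mxE mulrC.
Qed.

Lemma sign_F2D (a b : 'F_2) :
  (-1 : R) ^+ (a + b != 0) = (-1) ^+ (a != 0) * (-1) ^+ (b != 0).
Proof.
rewrite -signr_addb; congr (_ ^+ nat_of_bool _).
by case: (F2_cases a) => ->; case: (F2_cases b) => ->.
Qed.

Lemma chiC xi x : chi xi x = chi x xi.
Proof. by rewrite /chi dotC. Qed.

Lemma chiDr xi x y : chi xi (x + y) = chi xi x * chi xi y.
Proof. by rewrite /chi /dot linearD mulmxDr mxE sign_F2D. Qed.

Lemma chiDl xi eta x : chi (xi + eta) x = chi xi x * chi eta x.
Proof. by rewrite chiC chiDr !(chiC x). Qed.

Lemma chi0l x : chi 0 x = 1.
Proof. by rewrite /chi /dot mul0mx mxE eqxx. Qed.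

Lemma chi0r xi : chi xi 0 = 1.
Proof. by rewrite chiC chi0l. Qed.

Lemma chi_sq xi x : chi xi x * chi xi x = 1.
Proof. by rewrite -chiDr rV2_addxx chi0r. Qed.

Lemma norm_chi xi x : `|chi xi x| = 1.
Proof. by rewrite /chi normrX normrN1 expr1n. Qed.

Lemma chi_nontrivial xi : xi != 0 -> exists x, chi xi x = -1.
Proof.
case/rV0Pn => i xii; exists (delta_mx 0 i); rewrite /chi /dot.
rewrite mxE (bigD1 i) //= big1 ?addr0.
  by rewrite !mxE !eqxx mulr1 xii.
by move=> j ji; rewrite !mxE (negPf ji) andbF mulr0.
Qed.

Lemma avg_chi xi : avg (chi xi) = (xi == 0)%:R.
Proof.
have [->|xi0] := eqVneq xi 0.
  by rewrite (eq_avg chi0l) avg_cst ?card_rV2_gt0.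
have [y chiy] := chi_nontrivial xi0.
have : avg (chi xi) = - avg (chi xi); last by move=> ?; rewrite /=; lra.
rewrite -avgN -[LHS](avg_reindex _ (addIr y)); apply: eq_avg => x.
by rewrite chiDr chiy mulrN1.
Qed.

Lemma sum_chi x : \sum_xi chi xi x = #|{: G}|%:R * (x == 0)%:R.
Proof.
rewrite -avg_chi !avgE mulrA divff ?mul1r ?pnatr_eq0 -?lt0n ?card_rV2_gt0 //.
by apply: eq_bigr => xi _; rewrite chiC.
Qed.

Lemma fourier_inv f x : f x = \sum_xi fourier f xi * chi xi x.
Proof.
have G0 : (#|{: G}|%:R : R) != 0 by rewrite pnatr_eq0 -lt0n card_rV2_gt0.
rewrite /fourier; under eq_bigr do rewrite avgE -mulrA mulr_suml.
rewrite -mulr_sumr exchange_big /=.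
under eq_bigr => y _.
  under eq_bigr => xi _ do rewrite -mulrA -chiDr.
  rewrite -mulr_sumr sum_chi.
  over.
rewrite (bigD1 x) //= big1 ?addr0.
  by rewrite rV2_addxx eqxx mulr1 mulrCA mulVf ?mulr1.
move=> y yx; rewrite addr_eq0 rV2_opp (negPf yx) !mulr0 //.
Qed.

Lemma fourierD f g xi : fourier (fun x => f x + g x) xi = fourier f xi + fourier g xi.
Proof. by rewrite /fourier -avgD; apply: eq_avg => x; rewrite mulrDl. Qed.

Lemma fourierZ c f xi : fourier (fun x => c * f x) xi = c * fourier f xi.
Proof. by rewrite /fourier -avgZ; apply: eq_avg => x; rewrite mulrA. Qed.

Lemma fourier0 f : fourier f 0 = avg f.
Proof. by apply: eq_avg => x; rewrite chi0l mulr1. Qed.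

Lemma eq_fourier f g : f =1 g -> fourier f =1 fourier g.
Proof. by move=> fg xi; apply: eq_avg => x; rewrite fg. Qed.

Lemma fourier_conv f g xi : fourier (conv f g) xi = fourier f xi * fourier g xi.
Proof.
rewrite /fourier /conv; under eq_avg => x do rewrite -avgZr.
rewrite avg_swap -avgZr; apply: eq_avg => y /=.
rewrite -avgZ -[LHS](avg_reindex _ (addIr y)); apply: eq_avg => x /=.
by rewrite rV2_addK chiDr; ring.
Qed.

Lemma parseval f g : avg (fun x => f x * g x) = \sum_xi fourier f xi * fourier g xi.
Proof.
under eq_avg => x do rewrite (fourier_inv f) mulr_suml.
rewrite avg_sum; apply: eq_bigr => xi _; rewrite -avgZ.
by apply: eq_avg => x; ring.
Qed.

Lemma fourier_mul f g xi :
  fourier (fun x => f x * g x) xi = \sum_eta fourier f eta * fourier g (xi + eta).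
Proof.
rewrite /fourier; under eq_avg => x do rewrite -mulrA.
rewrite parseval; apply: eq_bigr => eta _; congr (_ * _).
by apply: eq_avg => x; rewrite chiDl mulrA.
Qed.

Lemma avg_conv f g : avg (conv f g) = avg f * avg g.
Proof. by rewrite -!fourier0 fourier_conv. Qed.

(** The Fourier transform turns products into convolutions, and a convolution of
    nonnegative functions is nonnegative: so positive-definiteness passes to powers. *)
Lemma fourier_exp_ge0 f k :
  (forall xi, 0 <= fourier f xi) -> forall xi, 0 <= fourier (fun x => f x ^+ k) xi.
Proof.
move=> f0; elim: k => [|k IH] xi.
  by rewrite /fourier; under eq_avg => x do rewrite expr0 mul1r; rewrite avg_chi.
rewrite (eq_fourier (g := fun x => f x * f x ^+ k)); last by move=> x; rewrite exprS.
by rewrite fourier_mul; apply: sumr_ge0 => eta _; rewrite mulr_ge0.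
Qed.

Lemma avg_exp_ge0 f k :
  (forall xi, 0 <= fourier f xi) -> 0 <= avg (fun x => f x ^+ k).
Proof. by move=> f0; rewrite -fourier0 fourier_exp_ge0. Qed.

End Fourier.

(** * Unbalancing the autocorrelation *)

Lemma exp_leq_bin (k p n : nat) : (k * p <= n)%N -> (k ^ p <= 'C(n, p))%N.
Proof.
elim: p n => [|p IH] n kp; first by rewrite expn0 bin0.
have [->|k0] := posnP k; first by rewrite exp0n.
case: n kp => [|n] kp; first by move: kp; rewrite leqn0 muln_eq0 eqn0Ngt k0.
rewrite -(leq_pmul2l (ltn0Sn p)) -mul_bin_diag expnS mulnCA mulnA.
apply: leq_mul => //.
by apply: IH; nia.
Qed.

Section Unbalancing.
Variables (R : realFieldType) (n : nat).
Local Notation G := ('rV['F_2]_n).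
Implicit Types (A B C : {set G}).

Definition autocorr A : G -> R := conv (ind R A) (ind R A).

Lemma autocorr_ge0 A x : 0 <= autocorr A x.
Proof. by apply: avg_ge0 => y; rewrite mulr_ge0 ?ind_ge0. Qed.

Lemma avg_autocorr A : avg (autocorr A) = dens R A ^+ 2.
Proof. by rewrite avg_conv. Qed.

Lemma autocorr_eq0 A x :
  (forall y z, y \in A -> z \in A -> y + z != x) -> autocorr A x = 0.
Proof.
move=> H; rewrite /autocorr /conv (eq_avg (g := fun _ => 0)) ?avg_cst ?card_rV2_gt0 //.
move=> y; rewrite /ind; case yA: (y \in A); last by rewrite mul0r.
case xyA: (x + y \in A); last by rewrite mulr0.
by have := H _ _ yA xyA; rewrite addrCA rV2_addxx addr0 eqxx.
Qed.

(** Subtracting the mean only kills the coefficient at 0, and every other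
    coefficient of an autocorrelation is a square. *)
Lemma fourier_autocorr_centered A xi :
  0 <= fourier (fun x => autocorr A x - dens R A ^+ 2) xi.
Proof.
rewrite fourierD fourier_conv.
have -> : fourier (fun=> - dens R A ^+ 2) xi = - dens R A ^+ 2 * avg (chi R xi).
  by rewrite -avgZ.
rewrite avg_chi; have [->|_] := eqVneq xi 0.
  by rewrite !fourier0 mulr1 expr2 subrr.
by rewrite mulr0 addr0 -expr2 sqr_ge0.
Qed.

(** If the autocorrelation of [A] vanishes on [C], then its deviation [f] from the
    mean [a ^+ 2] equals [- a ^+ 2] there, which makes an even moment of [f] large. The
    deviation is negative, whereas sifting needs the set where the autocorrelation is
    much above its mean. All moments of [f] are nonnegative, so in the binomial
    expansion of [(a ^+ 2 + f) ^+ (8 * p)] every term may be dropped except the one of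
    degree [2 * p] in [f], whose binomial coefficient, at least [4 ^ (2 * p)],
    compensates a small density of [C]. *)
Lemma unbalancing A C p :
    (forall x, x \in C -> autocorr A x = 0) ->
  'C(8 * p, 2 * p)%:R * dens R C * dens R A ^+ (16 * p) <=
  avg (fun x => autocorr A x ^+ (8 * p)).
Proof.
move=> AC; set a := dens R A; set f := fun x => autocorr A x - a ^+ 2.
have f0 := @avg_exp_ge0 _ _ f _ (fourier_autocorr_centered A).
have -> : avg (fun x => autocorr A x ^+ (8 * p)) =
  \sum_(i < (8 * p).+1) (a ^+ 2) ^+ (8 * p - i) * avg (fun x => f x ^+ i) *+ 'C(8 * p, i).
  rewrite (eq_avg (g := fun x =>
    \sum_(i < (8 * p).+1) ((a ^+ 2) ^+ (8 * p - i) * f x ^+ i) *+ 'C(8 * p, i))).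
    rewrite avg_sum; apply: eq_bigr => i _; rewrite -avgZ -mulr_natl -avgZ.
    by apply: eq_avg => x; rewrite mulr_natl.
  by move=> x; rewrite -exprDn /f addrC subrK.
have lt2p : (2 * p < (8 * p).+1)%N by lia.
rewrite (bigD1 (Ordinal lt2p)) //= ler_wpDr //.
  apply: sumr_ge0 => i _; rewrite mulrn_wge0 // mulr_ge0 ?f0 //.
  by rewrite exprn_ge0 ?sqr_ge0.
(* The even power is nonnegative off C and equals a ^+ (4 * p) on C. *)
suff key : dens R C * a ^+ (2 * (2 * p)) <= avg (fun x => f x ^+ (2 * p)).
  rewrite -[leRHS]mulr_natl -mulrA ler_wpM2l ?ler0n //.
  have -> : (16 * p = 2 * (8 * p - 2 * p) + 2 * (2 * p))%N by lia.
  rewrite exprD [_ * (_ * _)]mulrCA -exprM.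
  by apply: ler_wpM2l => //; rewrite exprn_ge0 ?dens_ge0.
rewrite mulrC -avgZ; apply: ler_avg => x; rewrite /ind.
case xC: (x \in C); last by rewrite mulr0 exprM exprn_ge0 ?sqr_ge0.
by rewrite /f (AC _ xC) sub0r mulr1 !exprM sqrrN.
Qed.

End Unbalancing.

(** * Sifting *)

Section Sifting.
Variables (R : realFieldType) (n : nat).
Local Notation G := ('rV['F_2]_n).
Implicit Types (A B C : {set G}).
Local Notation autocorr := (@autocorr R n).

Lemma avg_prod_ffun (T : finType) (q : nat) (F : T -> R) :
  avg (fun s : {ffun 'I_q -> T} => \prod_i F (s i)) = avg F ^+ q.
Proof.
rewrite !avgE -(bigA_distr_bigA (fun _ => F)) /= prodr_const card_ord.
by rewrite card_ffun card_ord exprMn natrX exprVn.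
Qed.

Definition translates_inter A q (s : {ffun 'I_q -> G}) : {set G} :=
  [set x | [forall i, x + s i \in A]].

Lemma ind_translates_inter A q (s : {ffun 'I_q -> G}) x :
  ind R (translates_inter A s) x = \prod_i ind R A (x + s i).
Proof.
rewrite /ind inE; case: forallP => [xs|/forallP].
  by rewrite big1 // => i _; rewrite xs.
by rewrite negb_forall => /existsP[i /negPf xi]; rewrite (bigD1 i) //= xi mul0r.
Qed.

Lemma avg_dens_translates_inter A q :
  avg (fun s : {ffun 'I_q -> G} => dens R (translates_inter A s)) = dens R A ^+ q.
Proof.
rewrite avg_swap (eq_avg (g := fun x => dens R A ^+ q)) ?avg_cst ?card_rV2_gt0 //.
move=> x; under eq_avg => s do rewrite ind_translates_inter.
rewrite (avg_prod_ffun q (fun t => ind R A (x + t))).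
by rewrite (avg_reindex _ (addrI x)).
Qed.

(** A pair [y, z + y] lies in the intersection of [q] random translates of [A] with
    probability [autocorr A z ^+ q]: a high moment of the autocorrelation is the
    expected autocorrelation of a random subset. *)
Lemma avg_autocorr_translates_inter A q (phi : G -> R) :
  avg (fun s : {ffun 'I_q -> G} =>
    avg (fun z => autocorr (translates_inter A s) z * phi z)) =
  avg (fun z => autocorr A z ^+ q * phi z).
Proof.
rewrite avg_swap; apply: eq_avg => z; rewrite avgZr; congr (_ * _).
rewrite avg_swap (eq_avg (g := fun x => autocorr A z ^+ q)) ?avg_cst ?card_rV2_gt0 //.
move=> y; under eq_avg => s do rewrite !ind_translates_inter -big_split /=.
rewrite (avg_prod_ffun q (fun t => ind R A (y + t) * ind R A (z + y + t))).
congr (_ ^+ q); rewrite -[RHS](avg_reindex _ (addrI y)); apply: eq_avg => t.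
by rewrite addrA.
Qed.

(** The hypothesis says that the desired inequality holds on average over
    [B = translates_inter A s], in view of the two preceding expectations. The term in
    [K] makes [phi] negligible for the pairs from [B], the term in [d] makes [B] dense. *)
Lemma sifting A q (phi : G -> R) (K d : R) :
    K * avg (fun z => autocorr A z ^+ q * phi z) + d * dens R A ^+ q <
      avg (fun z => autocorr A z ^+ q) ->
  exists B, K * avg (fun z => autocorr B z * phi z) + d * dens R B < dens R B ^+ 2.
Proof.
move=> H.
have S0 : (0 < #|{: {ffun 'I_q -> G}}|)%N by apply/card_gt0P; exists [ffun=> 0].
have [s Hs] := avg_le_max (fun s : {ffun 'I_q -> G} => let B := translates_inter A s in
   avg (autocorr B) - (K * avg (fun z => autocorr B z * phi z) + d * dens R B))
   S0.
exists (translates_inter A s); rewrite -avg_autocorr -subr_gt0.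
apply: lt_le_trans Hs => /=.
rewrite avgB avgD !avgZ avg_dens_translates_inter avg_autocorr_translates_inter.
have -> : avg (fun x : {ffun 'I_q -> G} => avg (autocorr (translates_inter A x))) =
   avg (fun z => autocorr A z ^+ q).
  rewrite -[RHS](eq_avg (f := fun z => autocorr A z ^+ q * 1)); last by move=> z; rewrite mulr1.
  rewrite -avg_autocorr_translates_inter; apply: eq_avg => s'.
  by apply: eq_avg => z; rewrite mulr1.
by rewrite subr_gt0.
Qed.

End Sifting.

(** * Concentration of sums of independent samples *)

Section Concentration.
Variable R : realType.

(** This follows from [1 - u <= expR (- u)] at [u = y - 2 * y ^+ 2], because
    [(1 + y) * (1 - u) = 1 + y ^+ 2 * (1 + 2 * y)]. *)
Lemma expR_quad_le (y : R) : `|y| <= 2^-1 -> expR (y - 2 * y ^+ 2) <= 1 + y.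
Proof.
rewrite ler_norml => /andP[y1 y2].
have := expR_ge1Dx (- (y - 2 * y ^+ 2)); rewrite expRN => H.
have u0 : 0 < 1 + - (y - 2 * y ^+ 2) by nra.
rewrite -[leLHS]invrK; apply: (@le_trans _ _ (1 + - (y - 2 * y ^+ 2))^-1).
  by rewrite lef_pV2 ?posrE ?invr_gt0 ?expR_gt0.
rewrite -[leLHS]mul1r ler_pdivrMr //.
have -> : (1 + y) * (1 + - (y - 2 * y ^+ 2)) = 1 + y ^+ 2 * (1 + 2 * y) by ring.
by rewrite lerDl mulr_ge0 ?sqr_ge0 //; lra.
Qed.

(** Products [\prod_i (1 + l * z i)] serve here in place of exponential moments:
    their averages are computed exactly, by independence, both for samples
    (in [chernoff_upper]) and for characters (in [chang]). *)
Lemma expR_prod_le (I : finType) (l : R) (z : I -> R) :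
    0 <= l <= 2^-1 -> (forall i, `|z i| <= 1) ->
  expR (l * \sum_i z i - 2 * l ^+ 2 * #|I|%:R) <= \prod_i (1 + l * z i).
Proof.
move=> /andP[l0 l1] z1.
apply: (@le_trans _ _ (\prod_i expR (l * z i - 2 * (l * z i) ^+ 2))).
  rewrite -expR_sum ler_expR sumrB -mulr_sumr lerD2l lerN2.
  rewrite -mulr_natr -[_%:R]mulr1n -sumr_const mulr_sumr.
  apply: ler_sum => i _; rewrite mulr1 exprMn mulrA ler_piMr //.
    by rewrite mulr_ge0 // sqr_ge0.
  by rewrite -real_normK ?num_real // expr_le1.
apply: ler_prod => i _; rewrite expR_ge0 expR_quad_le // normrM ger0_norm //.
by apply: le_trans l1; rewrite ler_piMr.
Qed.

Section Chernoff.
Variables (T : finType) (B : {set T}) (N : nat).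
Implicit Types (z : T -> R) (a : {ffun 'I_N -> T}).

(** The tuples from [B] are singled out inside all tuples by the weight
    [\prod_j ind R B (a j)], of average [dens R B ^+ N]. By independence
    [\prod_j (1 + l * z (a j))] has the same average against this weight, and it is at
    least [expR (N%:R * d ^+ 2 / 8)] wherever the sum exceeds [N%:R * d]; the choice
    [l = d / 4] optimizes this bound. *)
Lemma chernoff_upper z (d : R) :
    (forall t, `|z t| <= 1) -> avg (fun t => ind R B t * z t) = 0 -> 0 <= d <= 1 ->
  avg (fun a => \prod_j ind R B (a j) * (N%:R * d < \sum_j z (a j))%R%:R) <=
    expR (- (N%:R * d ^+ 2 / 8)) * dens R B ^+ N.
Proof.
move=> z1 z0 /andP[d0 d1]; set l := d / 4.
have l01 : 0 <= l <= 2^-1 by rewrite /l; apply/andP; split; lra.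
have -> : dens R B = avg (fun t => ind R B t * (1 + l * z t)).
  under [RHS]eq_avg => t do rewrite mulrDr mulr1 mulrCA.
  by rewrite avgD avgZ z0 mulr0 addr0.
rewrite -(avg_prod_ffun N) -avgZ; apply: ler_avg => a.
rewrite big_split /= mulrCA; apply: ler_wpM2l.
  by apply: prodr_ge0 => j _; apply: ind_ge0.
have zprod := expR_prod_le l01 (fun j => z1 (a j)).
case: ltP => /= [zs|_]; last first.
  by rewrite mulr_ge0 ?expR_ge0 // (le_trans _ zprod) ?expR_ge0.
rewrite expRN mulrC ler_pdivlMr ?expR_gt0 // mul1r; apply: le_trans zprod.
rewrite ler_expR card_ord /l.
have : d / 4 * (N%:R * d) <= d / 4 * \sum_j z (a j).
  by apply: ler_wpM2l; [lra | exact: ltW].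
by move=> ?; nra.
Qed.

Lemma chernoff z (d : R) :
    (forall t, `|z t| <= 1) -> avg (fun t => ind R B t * z t) = 0 -> 0 <= d <= 1 ->
  avg (fun a => \prod_j ind R B (a j) * (N%:R * d < `|\sum_j z (a j)|)%R%:R) <=
    2 * expR (- (N%:R * d ^+ 2 / 8)) * dens R B ^+ N.
Proof.
move=> z1 z0 d01; have H1 := chernoff_upper z1 z0 d01.
have z1' t : `|- z t| <= 1 by rewrite normrN.
have z0' : avg (fun t => ind R B t * - z t) = 0.
  by under eq_avg => t do rewrite mulrN; rewrite avgN z0 oppr0.
have H2 := chernoff_upper z1' z0' d01.
rewrite -mulrA mulr2n mulrDl mul1r; apply: le_trans (lerD H1 H2).
rewrite -avgD; apply: ler_avg => a; rewrite -mulrDr; apply: ler_wpM2l.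
  by apply: prodr_ge0 => j _; apply: ind_ge0.
rewrite sumrN lter_normr.
by case: (_ < _); case: (_ < _) => //=; rewrite ?addr0 ?add0r // lerDl.
Qed.

End Chernoff.
End Concentration.

(** * Almost periods *)

Section AlmostPeriods.
Variables (R : realType) (n : nat).
Local Notation G := ('rV['F_2]_n).
Implicit Types (T B : {set G}) (f : G -> R).

(** The Fourier coefficient at [xi] of the uniform probability on [T]. *)
Definition bias T (xi : G) : R :=
  (dens R T)^-1 * avg (fun t => ind R T t * chi R xi t).

Definition smooth T f : G -> R := fun x =>
  (dens R T)^-1 * avg (fun t => ind R T t * f (x + t)).

Lemma smooth_ge T f x (c : R) :
  (0 < #|T|)%N -> (forall t, t \in T -> c <= f (x + t)) -> c <= smooth T f x.
Proof.
rewrite -(dens_gt0 R) => T0 H.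
rewrite /smooth mulrC ler_pdivlMr // /dens -avgZ; apply: ler_avg => t.
by rewrite mulrC /ind; case: (boolP (t \in T)) => [/H|_]; rewrite ?mul1r ?mul0r.
Qed.

Lemma iter_smooth_ge T f (m : nat) x (c : R) :
    (0 < #|T|)%N ->
    (forall s : seq G, size s = m -> {subset s <= T} -> c <= f (x + \sum_(t <- s) t)) ->
  c <= iter m (smooth T) f x.
Proof.
move=> T0; elim: m x => [|m IH] x H.
  by have := H [::] erefl; rewrite big_nil addr0; apply.
apply: smooth_ge => // t tT; apply: IH => s sm sT.
have := H (t :: s); rewrite /= sm big_cons addrA; apply=> // u.
by rewrite inE => /predU1P[->|/sT].
Qed.

Lemma fourier_smooth T f xi :
  fourier (smooth T f) xi = bias T xi * fourier f xi.
Proof.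
rewrite fourierZ /bias -mulrA; congr (_ * _).
have -> : fourier (fun x => avg (fun t => ind R T t * f (x + t))) xi =
          fourier (conv f (ind R T)) xi.
  apply: eq_avg => x; congr (_ * _).
  rewrite -[LHS](avg_reindex _ (addrI x)); apply: eq_avg => y.
  by rewrite rV2_addKl mulrC.
by rewrite fourier_conv mulrC.
Qed.

Lemma conv_autocorr B f z :
  conv (autocorr R B) f z = avg (fun y => ind R B y * conv (ind R B) f (z + y)).
Proof.
rewrite /conv /autocorr /conv; under eq_avg => w do rewrite -avgZr.
rewrite avg_swap; apply: eq_avg => y; rewrite -avgZ.
rewrite -[LHS](avg_reindex _ (addrI y)); apply: eq_avg => w.
by rewrite (addrC y w) rV2_addK -mulrA -(addrA z) (addrC w).
Qed.

Section CrootSisask.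
Variables (B : {set G}) (phi : G -> R) (N : nat) (d : R).
Hypotheses (B0 : (0 < #|B|)%N) (phi01 : forall x, 0 <= phi x <= 1).
Hypotheses (N0 : (0 < N)%N) (d01 : 0 <= d <= 1).

Let g x : R := (dens R B)^-1 * conv (ind R B) phi x.
Let eta : R := 2 * expR (- (N%:R * d ^+ 2 / 8)).

Let B0' : 0 < dens R B. Proof. by rewrite dens_gt0. Qed.

Lemma smoothed_in01 x : 0 <= g x <= 1.
Proof.
rewrite /g mulr_ge0 ?invr_ge0 ?dens_ge0 //=.
  rewrite mulrC ler_pdivrMr // mul1r; apply: ler_avg => y.
  by rewrite ler_piMr ?ind_ge0 //; case/andP: (phi01 (x + y)).
by apply: avg_ge0 => y; rewrite mulr_ge0 ?ind_ge0 //; case/andP: (phi01 (x + y)).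
Qed.

Let bad (a : {ffun 'I_N -> G}) : R :=
  avg (fun x => (N%:R * d < `|\sum_j (phi (x + a j) - g x)|)%R%:R).

Lemma avg_bad :
  avg (fun a : {ffun 'I_N -> G} => \prod_j ind R B (a j) * bad a) <= eta * dens R B ^+ N.
Proof.
rewrite /bad; under eq_avg => a do rewrite -avgZ.
rewrite avg_swap -[leRHS](@avg_cst R G) ?card_rV2_gt0 //; apply: ler_avg => x.
apply: (chernoff N (z := fun t => phi (x + t) - g x)) => // [t|].
  have := phi01 (x + t); have := smoothed_in01 x.
  by move=> /andP[? ?] /andP[? ?]; rewrite ler_norml; apply/andP; split; lra.
under eq_avg => t do rewrite mulrBr.
by rewrite avgB avgZr -/(dens R B) /g mulVKf ?subrr // gt_eqF.
Qed.

Let good (a : {ffun 'I_N -> G}) : R :=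
  \prod_j ind R B (a j) * (bad a <= 2 * eta)%R%:R.

(** Markov's inequality applied to [avg_bad]. *)
Lemma avg_good : dens R B ^+ N / 2 <= avg good.
Proof.
have eta0 : 0 < eta by rewrite /eta mulr_gt0 ?expR_gt0.
have H : avg (fun a : {ffun 'I_N -> G} => \prod_j ind R B (a j)) = dens R B ^+ N.
  exact: avg_prod_ffun.
suff : dens R B ^+ N - avg good <= dens R B ^+ N / 2 by move=> ?; lra.
rewrite -H -avgB.
apply: (@le_trans _ _ (avg (fun a : {ffun 'I_N -> G} =>
    (2 * eta)^-1 * (\prod_j ind R B (a j) * bad a)))).
  apply: ler_avg => a; rewrite /good; set P := \prod_j _.
  have P0 : 0 <= P by apply: prodr_ge0 => j _; apply: ind_ge0.
  rewrite [leRHS]mulrCA -[X in X - _]mulr1 -mulrBr; apply: ler_wpM2l => //.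
  case: (leP (bad a)) => [_|/ltW bada] /=.
    by rewrite subrr mulr_ge0 ?invr_ge0 ?avg_ge0 // mulr_ge0 // ltW.
  by rewrite subr0 mulrC ler_pdivlMr ?mul1r // mulr_gt0.
rewrite avgZ H ler_pdivrMl ?mulr_gt0 ?expR_gt0 //; apply: le_trans avg_bad _.
by rewrite le_eqVlt; apply/orP; left; apply/eqP; field.
Qed.

(** Sample [N] points of [B]: the empirical average of [phi] over translates by the
    sample is close to [g], apart from a small set of points, for at least half of the
    samples. If the translates of one sample by [t] and by [t'] are both good, then [g] is
    almost invariant under [t + t']. Pigeonholing over the
    classes of samples modulo diagonal translation gives a class with many good
    members, and [T] is the set of the corresponding translations. *)
Lemma croot_sisask : exists T,
  dens R B ^+ N / 2 <= dens R T /\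
  forall t t', t \in T -> t' \in T ->
    avg (fun x => (2 * d < `|g (x + (t + t')) - g x|)%R%:R : R) <= 4 * eta.
Proof.
pose shift (b : {ffun 'I_N -> G}) t := [ffun j => b j + t].
pose Tb b := [set t | good (shift b t) != 0].
have S0 : (0 < #|{: {ffun 'I_N -> G}}|)%N by apply/card_gt0P; exists [ffun=> 0].
have good_le a : good a <= (good a != 0)%:R.
  rewrite /good; have [->//|_] := eqVneq; rewrite /= mulr_ile1 ?ler0n ?lern1 ?leq_b1 //.
    by apply: prodr_ge0 => j _; apply: ind_ge0.
  by apply: prodr_ile1 => j; rewrite ind_ge0 ind_le1.
have [b Hb] := avg_le_max (fun b => dens R (Tb b)) S0.
exists (Tb b); split.
  apply: le_trans Hb; apply: le_trans avg_good _.
  rewrite /dens avg_swap -[leLHS](@avg_cst R G) ?card_rV2_gt0 //.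
  apply: ler_avg => t.
  have shiftI : injective (shift^~ t).
    move=> b1 b2 /ffunP eqb; apply/ffunP => j.
    by have := eqb j; rewrite !ffunE => /addIr.
  by rewrite -(avg_reindex _ shiftI); apply: ler_avg => c; rewrite /ind inE.
pose H x := \sum_j phi (x + b j).
(* The sample b approximates every translate of g by an element of Tb b. *)
have near t : t \in Tb b ->
    avg (fun x => (N%:R * d < `|H x - N%:R * g (x + t)|)%R%:R : R) <= 2 * eta.
  rewrite inE /good mulf_eq0 negb_or pnatr_eq0 eqb0 negbK => /andP[_].
  rewrite /bad => bad_t; apply: le_trans bad_t.
  rewrite -[leRHS](avg_reindex _ (addIr t)) le_eqVlt; apply/orP; left; apply/eqP.
  apply: eq_avg => x; congr (nat_of_bool (_ < `|_|))%:R.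
  rewrite sumrB sumr_const card_ord mulr_natl; congr (_ - _).
  by apply: eq_bigr => j _; rewrite ffunE (addrC (b j)) addrA rV2_addK.
move=> t t' /near near_t /near near_t'.
have -> : 4 * eta = 2 * eta + 2 * eta by ring.
apply: le_trans (lerD near_t near_t'); rewrite -avgD.
rewrite -[leLHS](avg_reindex _ (addIr t')); apply: ler_avg => x.
rewrite addrACA rV2_addxx addr0 -natrD ler_nat.
case: (ltP (2 * d)) => //= big_gap; rewrite addn_gt0 !lt0b.
have N0' : 0 < N%:R :> R by rewrite ltr0n.
case: ltP => //= near1; rewrite ltNge; apply/negP => near2; move: big_gap.
rewrite ltNge => /negP; apply.
rewrite -(ler_pM2l N0') -[X in X * `|_|]ger0_norm ?ler0n // -normrM.
have -> : N%:R * (g (x + t) - g (x + t')) =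
    (H x - N%:R * g (x + t')) - (H x - N%:R * g (x + t)) by ring.
apply: le_trans (ler_normB _ _) _; lra.
Qed.

(** Errors and exceptional sets add up along the [k] pairs of summands. *)
Lemma even_sum_almost_period T (k : nat) (s : seq G) :
    (forall t t', t \in T -> t' \in T ->
      avg (fun x => (2 * d < `|g (x + (t + t')) - g x|)%R%:R : R) <= 4 * eta) ->
    size s = (2 * k)%N -> {subset s <= T} ->
  avg (fun x => (k%:R * (2 * d) < `|g (x + \sum_(t <- s) t) - g x|)%R%:R : R)
    <= k%:R * (4 * eta).
Proof.
move=> HT; elim: k s => [|k IH] s.
  rewrite muln0 => /size0nil -> _; rewrite !mul0r (eq_avg (g := fun=> 0)) ?avg_cst ?card_rV2_gt0 //.
  by move=> x; rewrite big_nil addr0 subrr normr0 ltxx.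
rewrite mulnS; case: s => [|t [|t' s]] //= [sz] sT.
have tT : t \in T by apply: sT; rewrite inE eqxx.
have t'T : t' \in T by apply: sT; rewrite !inE eqxx orbT.
have {}sT : {subset s <= T} by move=> u us; apply: sT; rewrite !inE us !orbT.
have {}IH := IH s sz sT.
rewrite -natr1 !(mulrDl k%:R 1) !mul1r.
apply: le_trans (lerD IH (HT _ _ tT t'T)).
rewrite -[X in _ <= X + _](avg_reindex _ (addIr (t + t'))) -avgD; apply: ler_avg => x.
rewrite !big_cons (addrA t) (addrA x) -natrD ler_nat.
case: (ltP (_ + _)) => //= big_gap; rewrite addn_gt0 !lt0b.
case: ltP => //= near1; rewrite ltNge; apply/negP => near2; move: big_gap.
rewrite ltNge => /negP; apply.
exact: le_trans (ler_distD (g (x + (t + t'))) _ _) (lerD near1 near2).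
Qed.

(** The exceptional set of density [k%:R * (4 * eta)] may be concentrated on [B], which
    is why it enters with weight [dens R B] only, whereas the uniform error enters with
    [dens R B ^+ 2]; later [eta] is taken much smaller than [dens R B]. *)
Lemma smooth_almost_invariant (k : nat) : exists T,
  dens R B ^+ N / 2 <= dens R T /\
  conv (autocorr R B) phi 0 - dens R B ^+ 2 * (k%:R * (2 * d))
      - dens R B * (k%:R * (4 * eta)) <=
    iter (2 * k) (smooth T) (conv (autocorr R B) phi) 0.
Proof.
have [T [Tdens HT]] := croot_sisask; exists T; split=> //.
have T0 : (0 < #|T|)%N.
  by rewrite -(dens_gt0 R) (lt_le_trans _ Tdens) // divr_gt0 // exprn_gt0.
apply: iter_smooth_ge => // s sz sT.
have {HT} := even_sum_almost_period HT sz sT; set S := \sum_(t <- s) t => Hs.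
rewrite add0r !conv_autocorr.
have convE x : conv (ind R B) phi x = dens R B * g x by rewrite /g mulVKf // gt_eqF.
set b := dens R B in convE *; set c := k%:R * (2 * d) in Hs *.
have b0 : 0 <= b by apply: dens_ge0.
have c0 : 0 <= c by rewrite /c mulr_ge0 // mulr_ge0 //; case/andP: d01.
have : avg (fun x => ind R B x * conv (ind R B) phi (0 + x)) <=
  avg (fun x => ind R B x * conv (ind R B) phi (S + x) + (b * c * ind R B x +
     b * (c < `|g (x + S) - g x|)%R%:R)).
  apply: ler_avg => x; rewrite add0r !convE (addrC S).
  have /andP[g0 g1] := smoothed_in01 x; have /andP[gS0 gS1] := smoothed_in01 (x + S).
  rewrite -/(g x) in g0 g1; rewrite -/(g (x + S)) in gS0 gS1.
  rewrite /ind; case: (x \in B); rewrite ?mul1r ?mulr1 ?mul0r ?mulr0 ?add0r; last first.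
    by rewrite mulr_ge0.
  rewrite -!mulrDr; apply: ler_wpM2l => //.
  case: (ltP c) => /= [_|]; first by lra.
  by rewrite ler_norml => /andP[]; lra.
rewrite !avgD !avgZ -/(dens R B) -/b => H1.
have H2 := ler_wpM2l b0 Hs.
have -> : b ^+ 2 * c = b * c * b by ring.
lra.
Qed.

End CrootSisask.
End AlmostPeriods.

(** * Dimension of the large spectrum *)

Section Chang.
Variables (R : realType) (n : nat).
Local Notation G := ('rV['F_2]_n).
Implicit Types (T : {set G}).
Local Notation bias := (@bias R n).

Lemma bias_le1 T xi : `|bias T xi| <= 1.
Proof.
have [T0|] := boolP (0 < dens R T); last first.
  by rewrite -leNgt => T0; rewrite /bias (_ : dens R T = 0) ?invr0 ?mul0r ?normr0 //;
     apply/eqP; rewrite eq_le T0 dens_ge0.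
rewrite /bias normrM normfV (ger0_norm (dens_ge0 _ _)) ler_pdivrMl // mulr1.
apply: le_trans (ler_norm_avg _) _; apply: ler_avg => t.
by rewrite normrM norm_chi mulr1 ger0_norm ?ind_ge0.
Qed.

Lemma chi_sum (I : finType) (xi : I -> G) x : chi R (\sum_i xi i) x = \prod_i chi R (xi i) x.
Proof. by rewrite (big_morph (fun u => chi R u x) (fun u v => chiDl R u v x) (chi0l R x)). Qed.

(** Independent characters behave as independent random signs: in the expansion of
    the product, every term but the constant one is a multiple of the character of a
    nontrivial combination of the rows of [X], which averages to 0. *)
Lemma avg_riesz_product r (X : 'M['F_2]_(r, n)) (l : 'I_r -> R) :
  row_free X -> avg (fun x => \prod_i (1 + l i * chi R (row i X) x)) = 1.
Proof.
move=> Xfree; pose v (J : {set 'I_r}) : 'rV['F_2]_r := \row_i (i \notin J)%:R.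
have -> : avg (fun x => \prod_i (1 + l i * chi R (row i X) x)) =
    \sum_(J : {set 'I_r}) (\prod_i (if i \in J then 1 else l i)) * avg (chi R (v J *m X)).
  rewrite (eq_avg (g := fun x => \sum_(J : {set 'I_r})
      (\prod_i (if i \in J then 1 else l i)) * chi R (v J *m X) x)).
    by rewrite avg_sum; apply: eq_bigr => J _; rewrite avgZ.
  move=> x; rewrite bigA_distr; apply: eq_bigr => J _.
  rewrite mulmx_sum_row chi_sum -big_split; apply: eq_bigr => i _ /=.
  by rewrite mxE; case: (i \in J); rewrite /= ?scale0r ?scale1r ?chi0l ?mulr1.
rewrite (bigD1 finset.setT) //= [X in _ + X]big1 ?addr0 => [|J JT].
  have -> : v finset.setT = 0 by apply/rowP => i; rewrite !mxE inE.
  by rewrite mul0mx avg_chi eqxx mulr1 big1 // => i _; rewrite inE.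
rewrite avg_chi mulmx_free_eq0 //.
have [v0|_] := eqVneq (v J) 0; last by rewrite mulr0.
case/eqP: JT; apply/finset.setP => i; rewrite inE; have /rowP/(_ i) := v0.
by rewrite !mxE; case: (i \in J) => //= /eqP; rewrite oner_eq0.
Qed.

(** The exponents [Y x] of the Riesz product [\prod_i (1 + l * z x i)] have average
    at least [r%:R / 32] over [T], because every sign [s i] agrees with the bias of [T].
    By convexity of the exponential the product then averages to at least
    [expR (r%:R / 32)] over [T], while it averages to 1 over the whole space; so [T]
    has density at most [expR (- r%:R / 32)]. *)
Lemma chang r (X : 'M['F_2]_(r, n)) T (K : nat) :
    row_free X -> (forall i, 2^-1 <= `|bias T (row i X)|) -> 2^-1 ^+ K <= dens R T ->
  (r <= 32 * K)%N.
Proof.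
move=> Xfree Xbias TK.
have T0 : 0 < dens R T by rewrite (lt_le_trans _ TK) // exprn_gt0.
pose s i : R := Num.sg (bias T (row i X)).
pose z x i : R := s i * chi R (row i X) x.
have z1 x i : `|z x i| <= 1 by rewrite normrM norm_chi mulr1 normr_sg lern1 leq_b1.
(* The value l = 1/8 maximizes l / 2 - 2 * l ^+ 2. *)
pose l : R := 8^-1.
have l01 : 0 <= l <= 2^-1 by rewrite /l; apply/andP; split; lra.
pose Y x := l * \sum_i z x i - 2 * l ^+ 2 * #|{: 'I_r}|%:R.
have Yavg : r%:R / 32 * dens R T <= avg (fun x => ind R T x * Y x).
  rewrite /Y; under eq_avg => x do rewrite mulrBr mulrCA mulr_sumr.
  rewrite avgB avgZ avgZr avg_sum -/(dens R T) card_ord.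
  have : \sum_(i < r) (dens R T / 2) <= \sum_(i < r) avg (fun x => ind R T x * z x i).
    apply: ler_sum => i _.
    have -> : avg (fun x => ind R T x * z x i) = dens R T * `|bias T (row i X)|.
      under eq_avg => x do rewrite /z mulrCA.
      rewrite avgZ -[RHS]mulrC /s normrEsg -mulrA; congr (_ * _).
      by rewrite /bias mulrAC mulVf ?mul1r // gt_eqF.
    exact: (ler_wpM2l (dens_ge0 R T) (Xbias i)).
  rewrite sumr_const card_ord -mulr_natr /l.
  set S := \sum_i _; set t := dens R T => H; nra.
have : expR (r%:R / 32) * dens R T <= 1.
  rewrite -[leRHS](avg_riesz_product (fun i => l * s i) Xfree) /dens -avgZ.
  apply: (@le_trans _ _ (avg (fun x => expR (r%:R / 32) *
      (ind R T x * Y x + (1 - r%:R / 32) * ind R T x)))).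
    rewrite avgZ [leRHS]avgZ; apply: ler_wpM2l; first exact: expR_ge0.
    rewrite avgD avgZ -/(dens R T) mulrBl mul1r; lra.
  apply: ler_avg => x.
  have H : expR (Y x) <= \prod_i (1 + l * s i * chi R (row i X) x).
    by under eq_bigr => i _ do rewrite -mulrA; apply: (expR_prod_le l01 (z1 x)).
  apply: le_trans H; rewrite /ind.
  case: (x \in T); rewrite ?mul0r ?mulr0 ?addr0 ?mulr0 ?expR_ge0 //= mulr1 mul1r.
  (* Convexity, as the tangent line of the exponential at r / 32. *)
  rewrite -[Y x in leRHS](subrK (r%:R / 32)) expRD mulrC.
  apply: ler_wpM2r; first exact: expR_ge0.
  by apply: le_trans (expR_ge1Dx _); lra.
have e2 : 2 <= expR 1 :> R by apply: le_trans (expR_ge1Dx 1).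
have eK : 2 ^+ K <= expR K%:R :> R.
  by rewrite -[K%:R]mulr1 expRM_natl; apply: lerXn2r; rewrite ?nnegrE ?expR_ge0.
move=> H; have : expR (r%:R / 32) <= expR K%:R :> R.
  apply: le_trans eK; rewrite -[leRHS]invrK -exprVn -[leRHS]mul1r ler_pdivlMr ?exprn_gt0 //.
  by apply: le_trans H; apply: ler_wpM2l; rewrite ?expR_ge0.
by rewrite ler_expR ler_pdivrMr // -natrM ler_nat mulnC.
Qed.

End Chang.

(** * Restriction to cosets of a subspace *)

Section Restriction.
Variables (R : realFieldType) (n m : nat) (U : 'M['F_2]_(m, n)).
Local Notation G := ('rV['F_2]_n).

Definition slice (A : {set G}) (x : G) : {set 'rV['F_2]_m} := [set y | x + y *m U \in A].

Lemma avg_slice (A : {set G}) : avg (fun x => dens R (slice A x)) = dens R A.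
Proof.
rewrite /dens avg_swap -[RHS](@avg_cst R 'rV['F_2]_m) ?card_rV2_gt0 //.
apply: eq_avg => y; rewrite -[RHS](avg_reindex _ (addIr (y *m U))).
by apply: eq_avg => x; rewrite /ind inE.
Qed.

Lemma fourier_slice (A : {set G}) xi :
  fourier (fun x => dens R (slice A x)) xi =
    fourier (ind R A) xi * avg (fun y => chi R xi (y *m U)).
Proof.
rewrite /fourier; under eq_avg => x do rewrite -avgZr.
rewrite avg_swap -avgZ; apply: eq_avg => y; rewrite -avgZr.
rewrite -[RHS](avg_reindex _ (addIr (y *m U))); apply: eq_avg => x.
by rewrite /ind inE chiDr -!mulrA chi_sq mulr1.
Qed.

(** The densities of the slices of [A] have the same Fourier coefficients as [A] at
    the characters that are trivial on the row space of [U]. So their second moment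
    exceeds [c * dens R A], whereas their mean is [dens R A]. *)
Lemma slice_increment (A : {set G}) (S : {set G}) (c : R) :
    (forall xi y, xi \in S -> chi R xi (y *m U) = 1) ->
    c * dens R A < \sum_(xi in S) fourier (ind R A) xi ^+ 2 ->
  exists x, c <= dens R (slice A x).
Proof.
move=> SU H; pose psi x := dens R (slice A x).
have [x Hx] := avg_le_max (fun x => psi x * psi x - c * psi x) (@card_rV2_gt0 n).
exists x; rewrite -/(psi x).
have psi0 : 0 <= psi x by apply: dens_ge0.
have : 0 < psi x * (psi x - c).
  rewrite mulrBr (mulrC _ c); apply: lt_le_trans Hx; rewrite avgB avgZ avg_slice subr_gt0.
  apply: lt_le_trans H _; rewrite parseval [leRHS](bigID (mem S)) /=; apply: ler_wpDr.
    by apply: sumr_ge0 => xi _; rewrite -expr2 sqr_ge0.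
  apply: ler_sum => xi xiS; rewrite fourier_slice (eq_avg (g := fun=> 1)).
    by rewrite avg_cst ?card_rV2_gt0 // mulr1 expr2.
  by move=> y; rewrite SU.
by rewrite leNgt; apply: contraL => ?; rewrite -leNgt mulr_ge0_le0 // subr_le0 ltW.
Qed.

End Restriction.

(** * The density increment *)

(** The number of samples is [sampling_factor * l ^ 4], which for the accuracy
    [d = 1 / (256 * l)] makes the exponent [N * d ^+ 2 / 8] equal to [10 * l ^ 2].
    Locked because unfolding this unary number would be costly. *)
HB.lock Definition sampling_factor : nat := 80 * (256 * 256).

Lemma sampling_factor_gt0 : (0 < sampling_factor)%N.
Proof. by rewrite unlock !muln_gt0. Qed.

Lemma natr_sampling_factor (R : pzSemiRingType) :
  sampling_factor%:R = 80 * (256 * 256) :> R.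
Proof. by rewrite unlock !natrM. Qed.

Definition sums_avoid n (D A : {set 'rV['F_2]_n}) :=
  forall x y, x \in D -> y \in D -> x + y \notin A.

Section DensityIncrement.
Variables (R : realType) (n : nat).
Local Notation G := ('rV['F_2]_n).
Implicit Types (A B D T : {set G}).

Lemma iter_smooth_mono T (c : R) (f g : G -> R) (m : nat) :
  (forall x, c * f x <= g x) ->
  forall x, c * iter m (smooth T) f x <= iter m (smooth T) g x.
Proof.
move=> fg; elim: m => [|m IH] x //=.
rewrite {1}/smooth mulrCA -avgZ; apply: ler_wpM2l; first by rewrite invr_ge0 dens_ge0.
by apply: ler_avg => t; rewrite mulrCA; apply: ler_wpM2l; rewrite ?ind_ge0.
Qed.

Lemma fourier_iter_smooth T (f : G -> R) (m : nat) xi :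
  fourier (iter m (smooth T) f) xi = bias R T xi ^+ m * fourier f xi.
Proof.
elim: m => [|m IH] /=; first by rewrite expr0 mul1r.
by rewrite fourier_smooth IH exprS mulrA.
Qed.

Lemma norm_fourier_ind A xi : `|fourier (ind R A) xi| <= dens R A.
Proof.
apply: le_trans (ler_norm_avg _) _; apply: ler_avg => x.
by rewrite normrM norm_chi mulr1 ger0_norm ?ind_ge0.
Qed.

Lemma sum_fourier_ind_sq A : \sum_xi fourier (ind R A) xi ^+ 2 = dens R A.
Proof.
under eq_bigr => xi _ do rewrite expr2.
rewrite -parseval; apply: eq_avg => x; rewrite /ind.
by case: (x \in A); rewrite ?mulr1 ?mulr0.
Qed.

Definition large_spectrum T : {set G} := [set xi | 2^-1 <= `|bias R T xi|].

(** On the Fourier side the smoothed value is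
    [\sum_xi bias T xi ^+ (2 * k) * fourier B xi ^+ 2 * fourier A xi ^+ 2]. Smoothing
    damps the frequencies outside the large spectrum by [4 ^ k] each, and Parseval
    for [A] sums them; bounding the coefficients of the much sparser set [B] trivially
    is what allows [k] to depend on the density of [A] only. *)
Lemma smooth_autocorr_le_spectrum A B T (k : nat) :
  iter (2 * k) (smooth T) (conv (autocorr R B) (autocorr R A)) 0 <=
  dens R B ^+ 2 * (\sum_(xi in large_spectrum T) fourier (ind R A) xi ^+ 2 + 4^-1 ^+ k * dens R A).
Proof.
have bias0 xi : 0 <= bias R T xi ^+ (2 * k) by rewrite exprM exprn_ge0 // sqr_ge0.
rewrite fourier_inv.
apply: (@le_trans _ _ (\sum_xi dens R B ^+ 2 *
    (bias R T xi ^+ (2 * k) * fourier (ind R A) xi ^+ 2))).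
  apply: ler_sum => xi _.
  rewrite chi0r mulr1 fourier_iter_smooth !fourier_conv -!expr2 mulrCA.
  apply: ler_wpM2r; first by rewrite mulr_ge0 ?sqr_ge0.
  rewrite -real_normK ?num_real //; apply: lerXn2r; rewrite ?nnegrE ?dens_ge0 //.
  exact: norm_fourier_ind.
rewrite -mulr_sumr; apply: ler_wpM2l; first exact: sqr_ge0.
rewrite -[in X in _ <= _ + X](sum_fourier_ind_sq A) (bigID (mem (large_spectrum T))) /=; apply: lerD.
  apply: ler_sum => xi _; rewrite ler_piMl ?sqr_ge0 // exprM exprn_ile1 ?sqr_ge0 //.
  by rewrite -real_normK ?num_real // exprn_ile1 // bias_le1.
rewrite mulr_sumr [leRHS](bigID (mem (large_spectrum T))) /= ler_wpDl //.
  by apply: sumr_ge0 => xi _; rewrite mulr_ge0 ?sqr_ge0 // exprn_ge0 // invr_ge0.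
apply: ler_sum => xi; rewrite inE -ltNge => small.
apply: ler_wpM2r; first exact: sqr_ge0.
rewrite exprM; apply: lerXn2r; rewrite ?nnegrE ?sqr_ge0 ?invr_ge0 //.
have := normr_ge0 (bias R T xi); rewrite -real_normK ?num_real //.
by set b := `|_| in small *; nra.
Qed.

(** Unbalancing gives the autocorrelation of [D] a moment of order [8 * l] which is at
    least [8 ^+ l] times that of the constant [a ^+ 2]. The points where it is below
    [9 / 8 * a ^+ 2] contribute at most [4 ^+ l] in the same unit, since [(9 / 8) ^+ 8 < 4]; the ratio
    [2 ^+ l] of the two absorbs the factor 128. Sifting then produces a set nearly all
    of whose differences are points of high autocorrelation. *)
Lemma sifted_set (l : nat) D A :
    (9 <= l)%N -> 2^-1 ^+ l <= dens R D -> 2^-1 ^+ l <= dens R A ->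
    sums_avoid D A ->
  exists B, [/\ 2^-1 ^+ (8 * l ^ 2) <= dens R B &
    dens R B ^+ 2 * (127 / 128) <=
      avg (fun z => autocorr R B z * (9 / 8 * dens R D ^+ 2 <= autocorr R D z)%R%:R)].
Proof.
move=> l9 Dl Al DDA; set a := dens R D in Dl *.
have a0 : 0 < a by rewrite (lt_le_trans _ Dl) // exprn_gt0.
pose low z : R := (autocorr R D z < 9 / 8 * a ^+ 2)%R%:R.
have big_moment : 8 ^+ l * a ^+ (16 * l) <= avg (fun z => autocorr R D z ^+ (8 * l)).
  apply: le_trans (@unbalancing R n D A l _); last first.
    move=> x xA; apply: autocorr_eq0 => y z yD zD.
    by apply: contraL (DDA _ _ yD zD) => /eqP->; rewrite negbK.
  apply: ler_wpM2r; first by rewrite exprn_ge0 // ltW.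
  have -> : 8 ^+ l = 16 ^+ l * 2^-1 ^+ l :> R by rewrite -exprMn; congr (_ ^+ _); lra.
  apply: ler_pM => //; rewrite ?exprn_ge0 //.
  have -> : 16 ^+ l = ((4 ^ (2 * l))%N)%:R :> R.
    by rewrite expnM natrX; congr (_ ^+ _); rewrite -natrX.
  by rewrite ler_nat exp_leq_bin //; lia.
have low_moment : avg (fun z => autocorr R D z ^+ (8 * l) * low z) <= 4 ^+ l * a ^+ (16 * l).
  rewrite -[leRHS](@avg_cst R G) ?card_rV2_gt0 //; apply: ler_avg => z; rewrite /low.
  case: ltP => [small|_]; last by rewrite mulr0 mulr_ge0 ?exprn_ge0 // ltW.
  rewrite mulr1; apply: (@le_trans _ _ ((9 / 8 * a ^+ 2) ^+ (8 * l))).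
    apply: lerXn2r; rewrite ?nnegrE ?autocorr_ge0 ?ltW //.
    exact: le_lt_trans (autocorr_ge0 R D z) small.
  rewrite exprMn -exprM (_ : (2 * (8 * l) = 16 * l)%N); last by lia.
  apply: ler_wpM2r; first by rewrite exprn_ge0 // ltW.
  by rewrite exprM; apply: lerXn2r; rewrite ?nnegrE ?exprn_ge0 //; lra.
have [|B HB] := @sifting R n D (8 * l) low 128 (a ^+ (8 * l)).
  have a16 : 0 < a ^+ (16 * l) by rewrite exprn_gt0.
  have -> : a ^+ (8 * l) * dens R D ^+ (8 * l) = a ^+ (16 * l).
    by rewrite -exprD; congr (_ ^+ _); lia.
  apply: lt_le_trans big_moment.
  have -> : 8 ^+ l = 2 ^+ l * 4 ^+ l :> R by rewrite -exprMn; congr (_ ^+ _); lra.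
  have l2 : 512 <= 2 ^+ l :> R.
    have -> : 512 = 2 ^+ 9 :> R by rewrite -natrX.
    by rewrite ler_eXn2l // ltr1n.
  have l4 : 1 <= 4 ^+ l :> R by rewrite exprn_ege1 // ler1n.
  apply: (@lt_le_trans _ _ (512 * 4 ^+ l * a ^+ (16 * l))).
    set u := 4 ^+ l in l4 low_moment *; set v := a ^+ _ in a16 low_moment *.
    by set w := avg _ in low_moment *; nra.
  by apply: ler_wpM2r; [exact: ltW | apply: ler_wpM2r => //; lra].
exists B.
have low0 : 0 <= avg (fun z => autocorr R B z * low z).
  by apply: avg_ge0 => z; rewrite mulr_ge0 ?autocorr_ge0 ?ler0n.
have B0 := dens_ge0 R B.
have aq0 : 0 < a ^+ (8 * l) by rewrite exprn_gt0.
split.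
  have : a ^+ (8 * l) <= dens R B.
    rewrite leNgt; apply/negP => small.
    have : dens R B ^+ 2 <= a ^+ (8 * l) * dens R B by nra.
    by lra.
  apply: le_trans; have -> : (8 * l ^ 2 = l * (8 * l))%N by rewrite mulnCA.
  by rewrite exprM; apply: lerXn2r; rewrite ?nnegrE ?exprn_ge0 // ltW.
have split_avg : avg (fun z => autocorr R B z * (9 / 8 * a ^+ 2 <= autocorr R D z)%R%:R) =
   dens R B ^+ 2 - avg (fun z => autocorr R B z * low z).
  rewrite -avg_autocorr -avgB; apply: eq_avg => z; rewrite /low.
  rewrite -[X in X - _]mulr1 -mulrBr; congr (_ * _).
  by case: ltP => _; rewrite ?subrr ?subr0.
rewrite split_avg.
have : 0 <= a ^+ (8 * l) * dens R B by rewrite mulr_ge0 // ltW.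
lra.
Qed.

Lemma smoothing_set (l : nat) (B S : {set G}) :
    (9 <= l)%N -> 2^-1 ^+ (8 * l ^ 2) <= dens R B ->
  exists T, 2^-1 ^+ (8 * l ^ 2 * (sampling_factor * l ^ 4) + 1) <= dens R T /\
    conv (autocorr R B) (ind R S) 0 - dens R B ^+ 2 / 64 <=
      iter (2 * l) (smooth T) (conv (autocorr R B) (ind R S)) 0.
Proof.
move=> l9 Bl; set N := (sampling_factor * l ^ 4)%N.
have l0 : 0 < l%:R :> R by rewrite ltr0n; lia.
have b0 : 0 < dens R B by rewrite (lt_le_trans _ Bl) // exprn_gt0.
pose d : R := (256 * l%:R)^-1.
have d01 : 0 <= d <= 1.
  have : 1 <= 256 * l%:R :> R; last first.
    move=> H; rewrite /d invr_ge0 invf_le1; first by rewrite H andbT; lra.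
    exact: lt_le_trans H.
  have : 9 <= l%:R :> R by rewrite ler_nat.
  lra.
have B0 : (0 < #|B|)%N by rewrite -(dens_gt0 R).
have S01 x : 0 <= ind R S x <= 1 by rewrite ind_ge0 ind_le1.
have N0 : (0 < N)%N by rewrite /N muln_gt0 sampling_factor_gt0 expn_gt0 (leq_trans _ l9).
have [T [Tdens HT]] := smooth_almost_invariant B0 S01 N0 d01 l.
exists T; split.
  apply: le_trans Tdens; rewrite exprD expr1 exprM; apply: ler_wpM2r => //.
  by apply: lerXn2r; rewrite ?nnegrE ?exprn_ge0 ?dens_ge0.
apply: le_trans HT; set b := dens R B in Bl b0 *.
have -> : l%:R * (2 * d) = 1 / 128 by rewrite /d; field; rewrite gt_eqF.
set E := expR _.
have -> : b ^+ 2 / 64 = b ^+ 2 * (1 / 128) + b * (b / 128) by field.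
suff : l%:R * (4 * (2 * E)) <= b / 128.
  move=> H; have := ler_wpM2l (ltW b0) H; lra.
suff : 1024 * l%:R * E <= b by move=> ?; lra.
apply: le_trans Bl; rewrite /E.
have -> : - (N%:R * d ^+ 2 / 8) = - (10 * l ^ 2)%:R :> R.
  have -> : N%:R = 80 * (256 * 256) * l%:R ^+ 4 :> R.
    by rewrite /N natrM natrX natr_sampling_factor.
  have -> : (10 * l ^ 2)%:R = 10 * l%:R ^+ 2 :> R by rewrite natrM natrX.
  by rewrite /d; field; rewrite gt_eqF.
have -> : 2^-1 ^+ (8 * l ^ 2) = 2^-1 ^+ (10 * l ^ 2) * 2 ^+ (2 * l ^ 2) :> R.
  have -> : (10 * l ^ 2 = 8 * l ^ 2 + 2 * l ^ 2)%N by lia.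
  by rewrite exprD -mulrA -exprMn mulVf // expr1n mulr1.
have E10 : 1024 = 2 ^+ 10 :> R by lra.
have Ele : expR (- (10 * l ^ 2)%:R) <= 2^-1 ^+ (10 * l ^ 2) :> R.
  rewrite expRN exprVn lef_pV2 ?posrE ?expR_gt0 ?exprn_gt0 //.
  have -> : expR (10 * l ^ 2)%:R = expR 1 ^+ (10 * l ^ 2) :> R.
    by rewrite -expRM_natl mulr1.
  apply: lerXn2r; rewrite ?nnegrE ?expR_ge0 //.
  exact: le_trans (expR_ge1Dx 1).
have lle : 2 ^+ 10 * l%:R <= 2 ^+ (2 * l ^ 2) :> R.
  rewrite -!natrX -natrM ler_nat; apply: (@leq_trans (2 ^ 10 * 2 ^ l)%N).
    by rewrite leq_mul2l (ltnW (ltn_expl _ _)) ?orbT.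
  rewrite -expnD leq_exp2l //; nia.
by rewrite E10 mulrC; apply: ler_pM => //; rewrite ?expR_ge0.
Qed.

(** For nearly all pairs from the sifted set [B], the autocorrelation of [D] at the
    difference is at least [9 / 8 * a ^+ 2]. Smoothing by the almost periods [T] loses
    little of this, and leaves only the large spectrum of [T]: the Fourier mass of [D]
    on it exceeds [17 / 16 * a ^+ 2]. By Chang's bound the large spectrum has rank
    [O(l ^ 6)], so its annihilator, the row space of [U], has small codimension, and
    some coset of it carries the increment. *)
Theorem density_increment (l : nat) D A :
    (9 <= l)%N -> 2^-1 ^+ l <= dens R D -> 2^-1 ^+ l <= dens R A ->
    sums_avoid D A ->
  exists (m : nat) (U : 'M['F_2]_(m, n)) (x : G),
    [/\ row_free U, (n <= m + 32 * (8 * l ^ 2 * (sampling_factor * l ^ 4) + 1))%N &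
      17 / 16 * dens R D <= dens R (slice U D x)].
Proof.
move=> l9 Dl Al DDA.
have [B [Bl HB]] := sifted_set l9 Dl Al DDA.
pose S := [set z | 9 / 8 * dens R D ^+ 2 <= autocorr R D z].
have [T [Tl HT]] := smoothing_set S l9 Bl.
pose M : 'M['F_2]_(#|large_spectrum T|, n) := \matrix_(i < #|large_spectrum T|) enum_val i.
pose U := row_base (kermx M^T).
exists (\rank (kermx M^T)), U.
have UM : U *m M^T = 0 by apply/sub_kermxP; rewrite eq_row_base.
have Uchi xi y : xi \in large_spectrum T -> chi R xi (y *m U) = 1.
  move=> xiT; rewrite chiC /chi /dot.
  have -> : xi = row (enum_rank_in xiT xi) M by rewrite rowK enum_rankK_in.
  by rewrite tr_row colE mulmxA -[y *m U *m _]mulmxA UM mulmx0 mul0mx mxE eqxx.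
set a := dens R D in Dl HB *.
have a0 : 0 < a by rewrite (lt_le_trans _ Dl) // exprn_gt0.
have b0 : 0 < dens R B by rewrite (lt_le_trans _ Bl) // exprn_gt0.
have large : 17 / 16 * a * a < \sum_(xi in large_spectrum T) fourier (ind R D) xi ^+ 2.
  have := smooth_autocorr_le_spectrum D B T l; set F := \sum_(xi in _) _ => H1.
  have conv0 : dens R B ^+ 2 * (127 / 128) <= conv (autocorr R B) (ind R S) 0.
    by apply: le_trans HB _; apply: ler_avg => z; rewrite add0r /ind inE.
  have mono x : 9 / 8 * a ^+ 2 * conv (autocorr R B) (ind R S) x <=
      conv (autocorr R B) (autocorr R D) x.
    rewrite -avgZ; apply: ler_avg => z; rewrite mulrCA; apply: ler_wpM2l.
      exact: autocorr_ge0.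
    rewrite /ind inE -/a; case: (leP (9 / 8 * a ^+ 2)) => [H|_] /=; last by rewrite mulr0 autocorr_ge0.
    by rewrite mulr1.
  have H2 := iter_smooth_mono T (2 * l) mono 0.
  have H3 : 9 / 8 * a ^+ 2 * (dens R B ^+ 2 * (125 / 128)) <=
      dens R B ^+ 2 * (F + 4^-1 ^+ l * a).
    apply: le_trans H1; apply: le_trans H2; apply: ler_wpM2l; last lra.
    by rewrite mulr_ge0 // sqr_ge0.
  have tail : 4^-1 ^+ l * a <= a ^+ 2 / 512.
    have -> : 4^-1 ^+ l = 2^-1 ^+ l * 2^-1 ^+ l :> R.
      by rewrite -exprMn; congr (_ ^+ _); lra.
    have l2 : 2^-1 ^+ l <= 1 / 512 :> R.
      have -> : 1 / 512 = 2^-1 ^+ 9 :> R by lra.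
      by rewrite ler_wiXn2l // invf_le1 // ler1n.
    have l0 : 0 <= 2^-1 ^+ l :> R by rewrite exprn_ge0.
    set u := 2^-1 ^+ l in l0 l2 Dl *.
    have : u * u <= 1 / 512 * a by apply: ler_pM.
    nra.
  have H4 : 9 / 8 * a ^+ 2 * (125 / 128) <= F + 4^-1 ^+ l * a.
    rewrite -(ler_pM2l (exprn_gt0 2 b0)); apply: le_trans H3.
    by rewrite le_eqVlt mulrCA eqxx.
  have a2 : 0 < a ^+ 2 by rewrite exprn_gt0.
  rewrite -mulrA -expr2; lra.
have [x Hx] := slice_increment Uchi large.
exists x; split=> //; first exact: row_base_free.
rewrite mxrank_ker mxrank_tr.
have := @chang R n _ (rowsub (maxrankfun M) M) T _ (maxrowsub_free M) _ Tl.
have : (\rank M <= n)%N by apply: rank_leq_col.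
move=> rn H; rewrite -leq_subLR subKn //; apply: H => i.
by rewrite row_rowsub rowK; have := enum_valP (maxrankfun M i); rewrite inE.
Qed.

End DensityIncrement.

(** * Subspaces avoiding a sparse set *)

Lemma card_rV2 n : #|{: 'rV['F_2]_n}| = (2 ^ n)%N.
Proof. by rewrite card_mx card_Fp // mul1n. Qed.

Lemma rV2_1 (a : 'rV['F_2]_1) : a = 0 \/ a = 1%:M.
Proof.
have [a0|a1] := F2_cases (a 0 0); [left|right];
  by apply/rowP => j; rewrite ord1 ?a0 ?a1 !mxE.
Qed.

(** Greedy choice of a basis: a subspace [W] that misses [X] and a vector [x] outside
    the sumset [X + W] span together a subspace that misses [X]. Putting 0 into the set
    to be missed makes the chosen vectors independent. *)
Lemma subspace_avoiding (n j : nat) (X : {set 'rV['F_2]_n}) :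
    (#|0%R |: X| * 2 ^ j <= 2 ^ n)%N ->
  exists U : 'M['F_2]_(j, n), row_free U /\ forall y, y != 0 -> y *m U \notin X.
Proof.
set X0 := 0 |: X => Xsmall.
suff [U HU] : exists U : 'M['F_2]_(j, n), forall y, y != 0 -> y *m U \notin X0.
  exists U; split.
    apply: inj_row_free => y yU; apply: contraTeq isT => /HU.
    by rewrite yU !inE eqxx.
  by move=> y /HU; rewrite !inE negb_or => /andP[].
elim: j Xsmall => [|j IH] Xsmall.
  by exists 0 => y; rewrite thinmx0 eqxx.
have X0gt : (0 < #|X0|)%N by apply/card_gt0P; exists 0; rewrite !inE eqxx.
have [|U HU] := IH.
  by apply: leq_trans Xsmall; rewrite leq_mul2l leq_exp2l // leqnSn orbT.
pose Y := [set p.1 + p.2 *m U | p in finset.setX X0 [set: 'rV['F_2]_j]%SET].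
have Ysmall : (#|Y| < 2 ^ n)%N.
  apply: leq_ltn_trans (leq_imset_card _ _) _.
  rewrite cardsX cardsT card_rV2; apply: leq_trans Xsmall.
  by rewrite ltn_pmul2l // ltn_exp2l.
have [x xY] : exists x, x \notin Y.
  apply/existsP; apply: contraLR Ysmall => /existsPn allY.
  rewrite -leqNgt -card_rV2 -cardsT; apply/subset_leq_card/fintype.subsetP => x _.
  by have := allY x; rewrite negbK.
have key a y : y != 0 \/ a = 1%:M -> a *m x + y *m U \notin X0.
  have [->|->] := rV2_1 a.
    by case=> [y0|/rowP/(_ 0)]; [rewrite mul0mx add0r HU | rewrite !mxE].
  move=> _; rewrite mul1mx; apply: contra xY => xyX.
  apply/imsetP; exists (x + y *m U, y); last by rewrite /= rV2_addK.
  by rewrite finset.in_setX xyX finset.in_setT.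
suff H (y : 'rV['F_2]_(1 + j)) : y != 0 -> y *m col_mx x U \notin X0.
  by exists (col_mx x U).
rewrite -[y]hsubmxK; move: (lsubmx y) (rsubmx y) => a b.
rewrite mul_row_col => ab0; apply: key.
have [b0|] := eqVneq b 0; last by left.
right; have [a0|//] := rV2_1 a.
by case/eqP: ab0; rewrite a0 b0 row_mx0.
Qed.

(** * Iterating over the colors *)

Section Iteration.
Variables (R : realType) (I : finType) (d l : nat).
Hypotheses (l9 : (9 <= l)%N) (Il : (#|I| * 2 ^ d <= 2 ^ l)%N).

Definition step_codim : nat := 32 * (8 * l ^ 2 * (sampling_factor * l ^ 4) + 1).

Definition unavoidable n (A : I -> {set 'rV['F_2]_n}) :=
  forall U : 'M['F_2]_(d, n), row_free U -> exists y i, y != 0 /\ y *m U \in A i.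

(** By [subspace_avoiding] the union of the [A i] cannot be sparse, so one of them
    has its fair share. *)
Lemma exists_dense n (A : I -> {set 'rV['F_2]_n}) :
  (d < n)%N -> unavoidable A -> exists i, 2^-1 ^+ l <= dens R (A i).
Proof.
move=> dn Aun.
suff [i Hi] : exists i, (2 ^ n <= #|A i| * 2 ^ l)%N.
  exists i; rewrite densE card_rV2 exprVn natrX ler_pdivlMl ?exprn_gt0 //.
  by rewrite ler_pdivrMr ?exprn_gt0 // -!natrX -natrM ler_nat.
have big_union : (2 ^ (n - d) <= \sum_i #|A i|)%N.
  pose X := \bigcup_i A i.
  have : (2 ^ n < #|0%R |: X| * 2 ^ d)%N.
    rewrite ltnNge; apply/negP => /subspace_avoiding[U [Ufree UX]].
    have [y [i [y0 yU]]] := Aun U Ufree.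
    by case/negP: (UX y y0); apply/bigcupP; exists i.
  rewrite -{1}(subnK (ltnW dn)) expnD ltn_pmul2r ?expn_gt0 // => /leq_trans H.
  have {H} : (2 ^ (n - d) < 1 + \sum_i #|A i|)%N.
    apply: H; apply: leq_trans (leq_card_setU _ _) _; rewrite cards1 leq_add2l.
    rewrite /X; elim/big_rec2: _ => [|i a B _ IH]; first by rewrite cards0.
    by apply: leq_trans (leq_card_setU _ _) _; rewrite leq_add2l.
  by rewrite add1n ltnS.
apply/existsP; apply: contraLR Il => /existsPn small; rewrite -ltnNge.
have H : (\sum_i (#|A i| * 2 ^ l + 1) <= #|I| * 2 ^ n)%N.
  rewrite -sum_nat_const; apply: leq_sum => i _; rewrite addn1 ltnNge; exact: small.
move: H; rewrite big_split /= sum1_card -big_distrl /= => H.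
have PS := leq_mul big_union (leqnn (2 ^ l)).
have nE : (2 ^ n = 2 ^ (n - d) * 2 ^ d)%N by rewrite -expnD subnK // ltnW.
have P0 : (0 < 2 ^ (n - d))%N by rewrite expn_gt0.
have a0 : (0 < 2 ^ l)%N by rewrite expn_gt0.
move: H PS P0 a0; rewrite {}nE; set S := (\sum_i _)%N.
move: (2 ^ (n - d))%N (2 ^ l)%N (2 ^ d)%N #|I| => P a b k H PS P0 a0.
rewrite ltnNge; apply/negP => kb; have := leq_mul (leqnn P) kb.
have : (0 < P * a)%N by rewrite muln_gt0 P0.
by case: k H kb => [|k] H kb; lia.
Qed.

(** Each 16 increments at least double the density, which starts at [2^-1 ^+ l]. *)
Lemma increments_le (u : nat) n (D : {set 'rV['F_2]_n}) :
  2^-1 ^+ l * (17 / 16) ^+ u <= dens R D -> (u <= 16 * l)%N.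
Proof.
move=> H; have {H} : (17 / 16) ^+ u <= 2 ^+ l :> R.
  have := le_trans H (dens_le1 R D).
  by rewrite exprVn ler_pdivrMl ?exprn_gt0 // mulr1.
have two_le : 2 ^+ l <= ((17 / 16) ^+ 16) ^+ l :> R.
  by apply: lerXn2r; rewrite ?nnegrE ?exprn_ge0 //; lra.
by move=> /le_trans/(_ two_le); rewrite -exprM ler_eXn2l //; lra.
Qed.

(** All sets are restricted to the same subspace, the [A j] to the subspace itself,
    the [D j] to cosets of it chosen separately for each [j]: differences of points of
    one coset lie in the subspace, so the hypotheses survive. For [j <> i] a coset on
    which [D j] is at least as dense as on the whole space exists by averaging. *)
Lemma restriction_step n (A D : I -> {set 'rV['F_2]_n}) (i : I) :
    (forall j, sums_avoid (A j) (A j)) ->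
    (forall j, sums_avoid (D j) (A j)) ->
    2^-1 ^+ l <= dens R (A i) -> 2^-1 ^+ l <= dens R (D i) -> unavoidable A ->
  exists m (A' D' : I -> {set 'rV['F_2]_m}),
    [/\ (forall j, sums_avoid (A' j) (A' j)),
        (forall j, sums_avoid (D' j) (A' j)),
        unavoidable A', (n <= m + step_codim)%N &
        forall j, (if j == i then 17 / 16 else 1) * dens R (D j) <= dens R (D' j)].
Proof.
move=> AA DA Al Dl Aun.
have [m [U [x0 [Ufree codim x0D]]]] := density_increment l9 Dl Al (DA i).
have /fin_all_exists[x Hx] j : exists x,
    (if j == i then 17 / 16 else 1) * dens R (D j) <= dens R (slice U (D j) x).
  have [->|_] := eqVneq j i; first by exists x0.
  rewrite mul1r -(avg_slice R U (D j)); exact/avg_le_max/card_rV2_gt0.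
exists m, (fun j => slice U (A j) 0), (fun j => slice U (D j) (x j)); split=> //.
- move=> j a b; rewrite !inE !add0r mulmxDl; exact: (AA j).
- move=> j a b; rewrite !inE add0r => aD bD; apply: contraNN (DA j _ _ aD bD).
  by rewrite addrACA rV2_addxx add0r mulmxDl.
- move=> V Vfree.
  have [|y [j [y0 yA]]] := Aun (V *m U); first by rewrite /row_free mxrankMfree.
  by exists y, j; rewrite inE add0r -mulmxA.
Qed.

(** Here [u j] counts the increments that color [j] has received. The set [D j] stands
    for a coset slice of an earlier [A j], taken when color [j] was first used; before that
    [u j = 0] and [D j] carries no information. *)
Definition increment_state n (A D : I -> {set 'rV['F_2]_n}) (u : I -> nat) :=
  [/\ (forall j, sums_avoid (A j) (A j)),
      (forall j, sums_avoid (D j) (A j)),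
      (forall j, u j = 0 \/ 2^-1 ^+ l * (17 / 16) ^+ u j <= dens R (D j)) &
      unavoidable A].

(** Take a color that is dense at present, and increment the density of its set
    [D i], which is taken to be [A i] if the color is used for the first time. *)
Lemma increment_state_step n (A D : I -> {set 'rV['F_2]_n}) (u : I -> nat) :
    increment_state A D u -> (d < n)%N ->
  exists m (A' D' : I -> {set 'rV['F_2]_m}) (u' : I -> nat),
    [/\ increment_state A' D' u', (n <= m + step_codim)%N &
        (\sum_j (16 * l - u' j) < \sum_j (16 * l - u j))%N].
Proof.
move=> [AA DA uD Aun] dn; have [i Al] := exists_dense dn Aun.
pose E j := if (j == i) && (u i == 0) then A j else D j.
have EA j : sums_avoid (E j) (A j).
  by rewrite /E; case: ifP => _; [exact: AA | exact: DA].
have uE : 2^-1 ^+ l * (17 / 16) ^+ u i <= dens R (E i).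
  rewrite /E eqxx /=; have [->|] := eqVneq (u i) 0; first by rewrite expr0 mulr1.
  by case: (uD i) => [->|].
have El : 2^-1 ^+ l <= dens R (E i).
  apply: le_trans uE; rewrite ler_peMr ?exprn_ge0 // exprn_ege1 //; lra.
have [m [A' [D' [AA' DA' Aun' nm D'E]]]] := restriction_step AA EA Al El Aun.
pose u' j := (u j + (j == i))%N.
have u'D j : u' j = 0 \/ 2^-1 ^+ l * (17 / 16) ^+ u' j <= dens R (D' j).
  have := D'E j; rewrite /u'; have [->|ji] := eqVneq j i => D'j.
    right; rewrite addn1 exprS mulrCA; apply: le_trans D'j.
    by apply: ler_wpM2l => //; lra.
  rewrite addn0; case: (uD j) => [|uDj]; [by left | right].
  by apply: le_trans uDj _; move: D'j; rewrite mul1r /E (negPf ji).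
exists m, A', D', u'; split=> //.
have ui : (u i < 16 * l)%N.
  case: (u'D i); rewrite /u' eqxx addn1 // => H.
  exact: increments_le H.
rewrite (bigD1 i) //= [ltnRHS](bigD1 i) //= /u' eqxx -addSn; apply: leq_add.
  by rewrite addn1; lia.
by apply: leq_sum => j /negPf->; rewrite addn0.
Qed.

Lemma dimension_le_potential (w n : nat) (A D : I -> {set 'rV['F_2]_n}) (u : I -> nat) :
    increment_state A D u -> (\sum_j (16 * l - u j) <= w)%N ->
  (n <= d + step_codim * w)%N.
Proof.
elim: w n A D u => [|w IH] n A D u st uw;
  (have [nd|dn] := leqP n d; first exact: leq_trans (leq_addr _ _));
  have [m [A' [D' [u' [st' nm lt_u]]]]] := increment_state_step st dn.
  by move: (leq_trans lt_u uw); rewrite ltn0.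
have H := IH _ _ _ _ st' (leq_trans lt_u uw).
by rewrite mulnS; lia.
Qed.

(** Each color receives at most [16 * l] increments, each at the cost of
    [step_codim], and increments are possible as long as the dimension exceeds [d]. *)
Theorem dimension_le n (A : I -> {set 'rV['F_2]_n}) :
    (forall j, sums_avoid (A j) (A j)) -> unavoidable A ->
  (n <= d + step_codim * (#|I| * (16 * l)))%N.
Proof.
move=> AA Aun.
apply: (@dimension_le_potential _ n A (fun=> finset.set0) (fun=> 0%N)).
  by split=> // [j x y|j]; [rewrite inE | left].
by rewrite sum_nat_const subn0.
Qed.

End Iteration.

(** * Colorings of lines and colorings of vectors *)

Section Coloring.
Variables (n r : nat) (C : line n -> 'I_r) (i0 : 'I_r).

(** The color [i0] is given to the zero vector, which spans no line. *)
Definition vector_color (x : 'rV['F_2]_n) : 'I_r := odflt i0 (omap C (insub <[x]>%VS)).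

Lemma line_vector (W : line n) : exists x, [/\ x != 0, val W = <[x]>%VS & vector_color x = C W].
Proof.
have W1 : \dim (val W) == 1%N := valP W.
pose x := vpick (val W).
have x0 : x != 0 by rewrite vpick0 -dimv_eq0 (eqP W1).
have WE : val W = <[x]>%VS.
  apply/eqP; rewrite eq_sym eqEdim (eqP W1) dim_vline x0 andbT.
  by rewrite -memvE memv_pick.
by exists x; rewrite /vector_color -WE valK.
Qed.

Lemma monochromatic_subspace k (U : 'M['F_2]_(k, n)) i :
    row_free U -> (forall y, y != 0 -> vector_color (y *m U) = i) ->
  exists V : {vspace 'rV['F_2]_n}, \dim V = k /\
    forall W : line n, (val W <= V)%VS -> C W = i.
Proof.
move=> Ufree Ui; pose f : 'Hom('rV['F_2]_k, 'rV['F_2]_n) := linfun (mulmxr U).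
exists (limg f); split.
  have /eqP kf : lker f == 0%VS; last by rewrite limg_dim_eq ?kf ?capv0 // dimvf dim_matrix mul1r.
  by apply/lker0P => a b; rewrite !lfunE /=; apply: row_free_inj.
move=> W WV; have [x [x0 WE <-]] := line_vector W.
have /memv_imgP[y _ xE] : x \in limg f by rewrite memvE -WE.
move: x0; rewrite xE lfunE /= => yU; apply: Ui.
by apply: contraNneq yU => ->; rewrite mul0mx.
Qed.

(** The nonzero vectors of the plane spanned by [x] and [y] are [x], [y] and
    [x + y]. *)
Lemma monochromatic_triple x y i :
    x != 0 -> y != 0 -> x + y != 0 ->
    vector_color x = i -> vector_color y = i -> vector_color (x + y) = i ->
  exists V : {vspace 'rV['F_2]_n}, \dim V = 2 /\
    forall W : line n, (val W <= V)%VS -> C W = i.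
Proof.
move=> x0 y0 xy0 xi yi xyi.
have H (v : 'rV['F_2]_(1 + 1)) : v != 0 ->
    v *m col_mx x y != 0 /\ vector_color (v *m col_mx x y) = i.
  rewrite -[v]hsubmxK; move: (lsubmx v) (rsubmx v) => a b.
  rewrite mul_row_col.
  by have [->|->] := rV2_1 a; have [->|->] := rV2_1 b;
     rewrite ?mul0mx ?mul1mx ?add0r ?addr0 ?row_mx0 ?eqxx.
apply: (@monochromatic_subspace 2 (col_mx x y)) => [|v v0]; last by case: (H v v0).
apply: inj_row_free => v vU; apply/eqP; apply: contraTT isT => v0.
by have [] := H v v0; rewrite vU eqxx.
Qed.

End Coloring.

(** * The Ramsey bound *)

(** In a counterexample the colors asking for a plane are sum-free by
    [monochromatic_triple], and every subspace of dimension [d] meets one of them. The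
    last color gets the empty class, so that ['I_r] itself indexes the classes. *)
Lemma ramsey_property_twos_then (R : realType) (r d l n : nat) :
    (0 < r)%N -> (9 <= l)%N -> (r * 2 ^ d <= 2 ^ l)%N ->
    (d + step_codim l * (r * (16 * l)) < n)%N ->
  ramsey_property (twos_then r d) n.
Proof.
move=> r0 l9 rl big_n C; apply: contrapT => noV.
have last_lt : (r.-1 < r)%N by rewrite prednK.
pose last := Ordinal last_lt.
pose c := vector_color C last.
pose A (i : 'I_r) : {set 'rV['F_2]_n} := [set x | [&& i.+1 != r, x != 0 & c x == i]].
have : (n <= d + step_codim l * (#|'I_r| * (16 * l)))%N.
  apply: (@dimension_le R _ d l l9 _ n A); first by rewrite card_ord.
  - move=> i x y; rewrite !inE => /and3P[ir x0 /eqP xi] /and3P[_ y0 /eqP yi].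
    apply/negP => /and3P[_ xy0 /eqP xyi]; apply: noV; exists i.
    have [V [dimV HV]] := monochromatic_triple x0 y0 xy0 xi yi xyi.
    by exists V; rewrite tnth_mktuple (negPf ir).
  - move=> U Ufree; apply: contrapT => avoid; apply: noV; exists last.
    have [y y0|V [dimV HV]] := @monochromatic_subspace _ _ C last _ U last Ufree.
      have yU0 : y *m U != 0 by rewrite mulmx_free_eq0.
      apply/eqP; apply: contraT => ci; exfalso; apply: avoid.
      exists y, (c (y *m U)); rewrite inE y0 yU0 eqxx !andbT; split=> //.
      apply: contra ci => /eqP ri; apply/eqP/val_inj => /=.
      by rewrite -[in RHS]ri.
    by exists V; rewrite tnth_mktuple /= prednK // eqxx.
by rewrite card_ord leqNgt big_n.
Qed.

Lemma ln2_ge_half (R : realType) : 2^-1 <= ln 2 :> R.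
Proof.
rewrite -[leLHS]expRK ler_ln ?posrE ?expR_gt0 //.
rewrite -[leLHS]invrK -expRN -[leRHS]invrK lef_pV2 ?posrE ?invr_gt0 ?expR_gt0 //.
by apply: le_trans (expR_ge1Dx _); lra.
Qed.

Lemma up_log2_le (R : realType) (r : nat) :
  (2 <= r)%N -> (up_log 2 r)%:R <= 1 + 2 * ln r%:R :> R.
Proof.
move=> r2; have lo := up_log_gtn (isT : 1 < 2)%N r2.
have u0 : (0 < up_log 2 r)%N by rewrite up_log_gt0.
have : ln ((2 ^ (up_log 2 r).-1)%:R : R) <= ln r%:R.
  by rewrite ler_ln ?posrE ?ltr0n ?expn_gt0 ?(leq_trans _ r2) // ler_nat ltnW.
rewrite natrX lnXn // -[_ *+ _]mulr_natr => H.
have -> : (up_log 2 r)%:R = (up_log 2 r).-1%:R + 1 :> R by rewrite natr1 prednK.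
have u1 := ler0n R (up_log 2 r).-1; have := ln2_ge_half R.
by set u := _.-1%:R in H u1 *; set a := ln 2 in H * => a2; nra.
Qed.

Lemma dimension_bound_le (r d l : nat) : (0 < r)%N -> (d < l)%N ->
  ((d + step_codim l * (r * (16 * l))).+1 <= (4096 * sampling_factor + 513) * r * l ^ 7)%N.
Proof.
move=> r0 dl; rewrite /step_codim; move: sampling_factor => s.
have l7 : (l <= l ^ 7)%N by rewrite -[leqLHS]expn1 leq_pexp2l // (leq_trans _ dl).
have -> : (32 * (8 * l ^ 2 * (s * l ^ 4) + 1) * (r * (16 * l)) =
           4096 * s * r * l ^ 7 + 512 * (r * l))%N.
  by ring.
have -> : ((4096 * s + 513) * r * l ^ 7 = 4096 * s * r * l ^ 7 + 513 * (r * l ^ 7))%N.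
  by ring.
have : (r * l <= r * l ^ 7)%N by rewrite leq_mul2l l7 orbT.
have : (l <= r * l ^ 7)%N by rewrite (leq_trans l7) // leq_pmull.
move: (4096 * s * r * l ^ 7)%N (r * l ^ 7)%N (r * l)%N => X Y Z; lia.
Qed.

Theorem theorem1p4 (R : realType) :
  exists C : R, 0 < C /\
    forall r d : nat, (2 <= r)%N -> (1 <= d)%N ->
      exists n : nat,
        is_ramsey_number (twos_then r d) n /\
        n%:R <= C * r%:R * (ln r%:R + d%:R) ^+ 7.
Proof.
pose K := (4096 * sampling_factor + 513)%N.
exists (K%:R * 11 ^+ 7); split.
  by rewrite mulr_gt0 ?exprn_gt0 // ltr0n addn_gt0 orbT.
move=> r d r2 d1; pose l := (d + up_log 2 r + 9)%N.
have l9 : (9 <= l)%N by rewrite leq_addl.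
have rl : (r * 2 ^ d <= 2 ^ l)%N.
  apply: (@leq_trans (2 ^ up_log 2 r * 2 ^ d)%N); first by rewrite leq_mul2r up_logP ?orbT.
  by rewrite -expnD leq_exp2l // /l; lia.
pose n0 := (d + step_codim l * (r * (16 * l))).+1.
have Rn0 : ramsey_property (twos_then r d) n0.
  exact: (ramsey_property_twos_then R) (ltnW r2) l9 rl (ltnSn _).
have exR : exists n, `[< ramsey_property (twos_then r d) n >] by exists n0; apply/asboolP.
case: (ex_minnP exR) => n /asboolP Rn n_min.
exists n; split; first by split=> // m Rm; apply: n_min; apply/asboolP.
have nn0 : (n <= n0)%N by apply: n_min; apply/asboolP.
have n0K : (n0 <= K * r * l ^ 7)%N.
  by apply: dimension_bound_le; [exact: ltnW | rewrite /l; lia].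
have lL : l%:R <= 11 * (ln r%:R + d%:R) :> R.
  have lnr : 0 <= ln r%:R :> R by rewrite ln_ge0 // ler1n ltnW.
  have := up_log2_le R r2; have : 1 <= d%:R :> R by rewrite ler1n.
  by rewrite /l !natrD; lra.
apply: (@le_trans _ _ ((K * r * l ^ 7)%:R)); first by rewrite ler_nat (leq_trans nn0).
rewrite (natrM _ (K * r)) (natrM _ K) natrX.
have -> : K%:R * 11 ^+ 7 * r%:R * (ln r%:R + d%:R) ^+ 7 =
    K%:R * r%:R * (11 * (ln r%:R + d%:R)) ^+ 7 :> R by rewrite exprMn; ring.
apply: ler_wpM2l; first by rewrite mulr_ge0 ?ler0n.
apply: lerXn2r => //; rewrite nnegrE ?ler0n //.
exact: le_trans lL.
Qed.
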